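(* Let $1<p<2$. Let $B$ be a Blaschke product whose sequence of zeros $\{a_n\}_{n\ge1}$ is uniformly discrete. If $B' \in A^p$, then $$\sum_{n} (1-|a_n|)^{2-p} < \infty.$$
   Context: $U$ denotes the open unit disc in $\mathbb{C}$. If $\{a_n\}_{n\ge1}$ is a sequence of complex numbers with $0<|a_n|<1$ for all $n$ and $\sum_{n=1}^\infty (1-|a_n|)<\infty$, the Blaschke product with zeros $\{a_n\}$ is the analytic function on $U$ given by $$B(z) = \prod_{n=1}^{\infty} \frac{\bar a_n}{|a_n|}\,\frac{a_n - z}{1-\bar a_n z}.$$ A sequence $\{a_n\}$ in $U$ is uniformly discrete (or separated) if there is a constant $\delta>0$ such that $\rho(a_m,a_n)\ge\delta$ for all $m\neq n$, where $\rho(z,w)=\left|\frac{z-w}{1-\bar w z}\right|$ for $z,w\in U$ is the pseudohyperbolic metric. For $0<p<\infty$, a function $f$ analytic in $U$ belongs to $A^p$ if $\frac1\pi \iint_U |f(z)|^p\, dA(z) < \infty$, where $dA$ is Lebesgue area measure. *)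

(* Defs.v *)
From HB Require Import structures.
From mathcomp Require Import all_boot all_order all_algebra.
From mathcomp Require Import complex.
From mathcomp Require Import all_classical all_reals all_analysis.

Set Implicit Arguments.
Unset Strict Implicit.
Unset Printing Implicit Defensive.

Import Order.TTheory GRing.Theory Num.Theory.
Import numFieldNormedType.Exports.

Local Open Scope classical_set_scope.
Local Open Scope ring_scope.
Local Open Scope complex_scope.

(* Packing R[i] as a numFieldType gives it the topology and the normed-module
   structure over itself that every numFieldType carries in MathComp-Analysis;
   in particular [derivable f z 1] and [derive1 f z] are complex
   differentiability and the complex derivative. The wrappers below keep terms
   at this type, so that the ring operations are taken from this instance. *)
Definition Cplx (R : realType) : numFieldType := R[i].

Definition cplx (R : realType) (x y : R) : Cplx R := x +i* y.

(* The R-valued modulus: the norm [`|z|] of [Cplx R] is itself [Cplx R]-valued. *)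
Definition cmod (R : realType) (z : Cplx R) : R := Normc.normc z.

Definition cconj (R : realType) (z : Cplx R) : Cplx R := conjc z.

Definition unit_disc (R : realType) : set (Cplx R) :=
  [set z : Cplx R | cmod z < 1].

Definition analytic_in_disc (R : realType) (f : Cplx R -> Cplx R) : Prop :=
  forall z : Cplx R, unit_disc z -> derivable f z 1.

Definition blaschke_sequence (R : realType) (a : nat -> Cplx R) : Prop :=
  (forall n, 0 < cmod (a n) < 1) /\
  cvgn (series (fun n => 1 - cmod (a n) : R)).

Definition blaschke_factor (R : realType) (a z : Cplx R) : Cplx R :=
  cconj a / cplx (cmod a) 0 * ((a - z) / (1 - cconj a * z)).

(* Only the values on the unit disc are meaningful. *)
Definition blaschke (R : realType) (a : nat -> Cplx R) (z : Cplx R) : Cplx R :=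
  limn (fun N => \prod_(0 <= n < N) blaschke_factor (a n) z : Cplx R).

Definition pseudohyperbolic (R : realType) (z w : Cplx R) : R :=
  cmod ((z - w) / (1 - cconj w * z)).

Definition uniformly_discrete (R : realType) (a : nat -> Cplx R) : Prop :=
  exists2 delta : R, 0 < delta &
    forall m n : nat, m != n -> delta <= pseudohyperbolic (a m) (a n).

(* Area measure is the product of two copies of Lebesgue measure on the real
   line, (x, y) standing for x + iy. *)
Definition bergman (R : realType) (p : R) (f : Cplx R -> Cplx R) : Prop :=
  analytic_in_disc f /\
  ((pi^-1)%:E *
   \int[lebesgue_measure \x lebesgue_measure]_(w in
       [set w : measurableTypeR R * measurableTypeR R |
          unit_disc (cplx w.1 w.2)])
     (cmod (f (cplx w.1 w.2)) `^ p)%:E < +oo)%E.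

(* Main.v *)
Require Import Defs.
From HB Require Import structures.
From mathcomp Require Import all_boot all_order all_algebra.
From mathcomp Require Import complex.
From mathcomp Require Import all_classical all_reals all_analysis.
From mathcomp Require Import measurable_realfun ring lra.
Import Order.TTheory GRing.Theory Num.Theory.
Import numFieldNormedType.Exports.
Local Open Scope classical_set_scope.
Local Open Scope ring_scope.

Set Implicit Arguments.
Unset Strict Implicit.
Unset Printing Implicit Defensive.

(** Let h denote the gap 1 - |a| of a zero a, let depth be 1 - |z|^2, and put
tau = (p - 1) / 2. The sum of the powers h^(2 - p) is compared with the area
integral of |B'|^p by looking at B on vertical lines.

Consider a zero a with imaginary part at least 1/2 and a vertical line whose
abscissa is within eps h of Re a: these abscissae form the shadow of a. At the
height of a the modulus |B| is small on the line, while near the circle it is,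
on average, close to 1. The integral of |B'| over the part of the line above a is
therefore bounded below. Where |B'| exceeds a threshold proportional to
(h depth)^(-1/2) it is dominated by a multiple of (h depth)^tau |B'|^p, and the
threshold itself has a small integral, so that (h depth)^tau |B'|^p also has an
integral bounded below (segment_energy_ge). Multiplication by h^(1 - p) and
integration over the shadow, whose width is a multiple of h, turn this into a
bound for h^(2 - p) by the integral of (depth / h)^tau |B'|^p above the shadow.

It remains to add these bounds. At a given point only the zeros below it whose
shadow contains its abscissa contribute. Two such zeros have almost the same real
part on the scale of their gaps, so uniform discreteness forces their depths on
the line to differ by a fixed factor (near_zero_sep). The weights
(depth / h)^tau are then bounded by a geometric series, whatever the number of
zeros (cluster_sum_le, vertical_cluster). The total is at most a constant times
the integral of |B'|^p, up to an error coming from 1 - |B| on a circle of radius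
1 - s. This error vanishes as s tends to 0, because 1 - |B| is bounded by a
sum of Poisson kernels with masses proportional to the gaps, which are summable
(boundary_majorant_small).

A zero with gap at most 1/4 acquires imaginary part at least 1/2 after some
rotation by a multiple of a right angle, and these rotations preserve the area
integral; for the other zeros h^(2 - p) is at most 1, hence at most 4 h.

Differentiability of B, and the identification of its derivative with the limit
of those of the partial products, come from a first order expansion of the
partial products whose remainder is bounded uniformly in the number of factors
(partial_blaschke_remainder). *)

(** * Modulus and convergence of complex numbers *)

Section ComplexModulus.
Context {R : realType}.
Implicit Types z w : Cplx R.

Definition cre z : R := complex.Re z.
Definition cim z : R := complex.Im z.

Lemma cplx_eta z : z = cplx (cre z) (cim z).
Proof. by case: z. Qed.

Lemma normE z : `|z| = cplx (cmod z) 0.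
Proof. by []. Qed.

Lemma cmod_ge0 z : 0 <= cmod z.
Proof. by case: z => x y; rewrite /cmod /= sqrtr_ge0. Qed.

Lemma cmod_cplx (x y : R) : cmod (cplx x y) = Num.sqrt (x ^+ 2 + y ^+ 2).
Proof. by []. Qed.

Lemma sqr_cmod z : cmod z ^+ 2 = cre z ^+ 2 + cim z ^+ 2.
Proof. by case: z => x y; rewrite /cmod /= sqr_sqrtr// addr_ge0 ?sqr_ge0. Qed.

Lemma cmodM z w : cmod (z * w) = cmod z * cmod w.
Proof. exact: Normc.normcM. Qed.

Lemma cmodD z w : cmod (z + w) <= cmod z + cmod w.
Proof.
by have := ler_normD z w; rewrite !normE lecE /= => /andP[].
Qed.

Lemma cmod_eq0 z : (cmod z == 0) = (z == 0).
Proof.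
apply/eqP/eqP => [|->]; first exact: Normc.eq0_normc.
exact: Normc.normc0.
Qed.

Lemma cmod0 : cmod (0 : Cplx R) = 0.
Proof. by apply/eqP; rewrite cmod_eq0. Qed.

Lemma cmod1 : cmod (1 : Cplx R) = 1.
Proof. exact: Normc.normc1. Qed.

Lemma cmodN z : cmod (- z) = cmod z.
Proof. exact: normcN. Qed.

Lemma cmodV z : cmod z^-1 = (cmod z)^-1.
Proof. exact: Normc.normcV. Qed.

Lemma cmodf z w : cmod (z / w) = cmod z / cmod w.
Proof. by rewrite cmodM cmodV. Qed.

Lemma cmodBC z w : cmod (z - w) = cmod (w - z).
Proof. by rewrite -cmodN opprB. Qed.

Lemma cmod_subl z w : cmod z - cmod w <= cmod (z - w).
Proof. by rewrite lerBlDr -{1}(subrK w z) cmodD. Qed.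

Lemma cmod_dist z w : `|cmod z - cmod w| <= cmod (z - w).
Proof. by rewrite ler_norml cmod_subl andbT lerNl opprB cmodBC cmod_subl. Qed.

Lemma cmod_gt0 z : (0 < cmod z) = (z != 0).
Proof. by rewrite lt0r cmod_ge0 cmod_eq0 andbT. Qed.

Lemma cmod_real (x : R) : cmod (cplx x 0) = `|x|.
Proof. by rewrite cmod_cplx expr0n/= addr0 sqrtr_sqr. Qed.

Lemma cmod_imag (y : R) : cmod (cplx 0 y) = `|y|.
Proof. by rewrite cmod_cplx expr0n/= add0r sqrtr_sqr. Qed.

Lemma cre_le z : `|cre z| <= cmod z.
Proof.
rewrite -(@ler_pXn2r _ 2) ?nnegrE ?cmod_ge0// real_normK ?num_real//.
by rewrite sqr_cmod lerDl sqr_ge0.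
Qed.

Lemma cim_le z : `|cim z| <= cmod z.
Proof.
rewrite -(@ler_pXn2r _ 2) ?nnegrE ?cmod_ge0// real_normK ?num_real//.
by rewrite sqr_cmod lerDr sqr_ge0.
Qed.

Lemma cmod_le_reim z : cmod z <= `|cre z| + `|cim z|.
Proof.
rewrite -(@ler_pXn2r _ 2) ?nnegrE ?cmod_ge0// ?addr_ge0//.
rewrite sqr_cmod sqrrD !real_normK ?num_real// -addrA [X in _ <= _ + X]addrC.
by rewrite addrA lerDl mulrn_wge0// mulr_ge0.
Qed.

Lemma cmod_conj z : cmod (cconj z) = cmod z.
Proof. by case: z => x y; rewrite /cmod /= sqrrN. Qed.

Lemma cconjM z w : cconj (z * w) = cconj z * cconj w.
Proof. exact: (rmorphM (@conjc R)). Qed.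

Lemma cconjK z : cconj (cconj z) = z.
Proof. exact: (@conjcK R). Qed.

Lemma mul_cconj z : z * cconj z = cplx (cmod z ^+ 2) 0.
Proof.
rewrite sqr_cmod; case: z => x y; apply/eqP; rewrite eq_complex /=.
by apply/andP; split; apply/eqP; ring.
Qed.

Lemma cplxD (x y x' y' : R) : cplx x y + cplx x' y' = cplx (x + x') (y + y').
Proof. by []. Qed.

Lemma cplxN (x y : R) : - cplx x y = cplx (- x) (- y).
Proof. by []. Qed.

Lemma cplxM (x y x' y' : R) :
  cplx x y * cplx x' y' = cplx (x * x' - y * y') (x * y' + y * x').
Proof. by []. Qed.

Lemma creD z w : cre (z + w) = cre z + cre w.
Proof. by case: z; case: w. Qed.
Lemma creN z : cre (- z) = - cre z.
Proof. by case: z. Qed.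
Lemma cimD z w : cim (z + w) = cim z + cim w.
Proof. by case: z; case: w. Qed.
Lemma cimN z : cim (- z) = - cim z.
Proof. by case: z. Qed.

Lemma lt_norm_cplx z (e : R) : (`|z| < cplx e 0) = (cmod z < e).
Proof. by rewrite normE ltcE /= eqxx. Qed.

Lemma cplx_gt0 (e : R) : (0 < cplx e 0 :> Cplx R) = (0 < e).
Proof. by rewrite ltcE /= eqxx. Qed.

Lemma cnbhsP z (A : set (Cplx R)) :
  nbhs z A <-> exists2 e : R, 0 < e & forall w, cmod (w - z) < e -> A w.
Proof.
rewrite -nbhs_ballE; split.
  case=> -[x y] /=; rewrite ltcE /= => /andP[/eqP -> x0] H; exists x => // w wz.
  by apply: H; rewrite /ball /= distrC -/(cplx x 0) lt_norm_cplx.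
case=> e e0 H; exists (cplx e 0) => /=; first by rewrite cplx_gt0.
by move=> w; rewrite /ball /= distrC lt_norm_cplx; exact: H.
Qed.

Lemma ccvgP T (F : set_system T) {FF : Filter F} (f : T -> Cplx R) z :
  f @ F --> z <-> forall e : R, 0 < e -> \forall x \near F, cmod (f x - z) < e.
Proof.
split=> [fz e e0|H A /cnbhsP[e e0 eA]].
  have /fz : nbhs z [set w | cmod (w - z) < e] by apply/cnbhsP; exists e.
  exact.
by apply: filterS (H e e0) => x; exact: eA.
Qed.

(** The two coordinates are real sequences with absolutely summable increments. *)
Lemma csummable_cvg (u : nat -> Cplx R) (c : nat -> R) :
  (forall n, cmod (u n.+1 - u n) <= c n) -> cvgn (series c) -> cvgn u.
Proof.
move=> uc cc.
have K (f : Cplx R -> R) : (forall z w, f (z - w) = f z - f w) ->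
    (forall z, `|f z| <= cmod z) -> cvgn (f \o u).
  move=> fB fle.
  have H : cvgn (series (fun n => f (u n.+1 - u n))).
    apply: normed_cvg; apply: series_le_cvg cc => n //=.
      by apply: le_trans (uc n); exact: cmod_ge0.
    by apply: le_trans (uc n); exact: fle.
  have -> : f \o u = (fun n => f (u 0%N) + series (fun n => f (u n.+1 - u n)) n).
    apply/funext => n /=; rewrite /series /=.
    under eq_bigr do rewrite fB.
    by rewrite telescope_sumr// addrC subrK.
  by apply: is_cvgD => //; exact: is_cvg_cst.
have cr := K cre (fun z w => etrans (creD _ _) (congr1 _ (creN _))) cre_le.
have ci := K cim (fun z w => etrans (cimD _ _) (congr1 _ (cimN _))) cim_le.
apply/cvg_ex; exists (cplx (limn (cre \o u)) (limn (cim \o u))).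
apply/ccvgP => e e0.
have e2 : 0 < e / 2 by rewrite divr_gt0.
move/cvgr_dist_lt: (cr) => /(_ _ e2) Hr; move/cvgr_dist_lt: (ci) => /(_ _ e2) Hi.
near=> n.
apply: le_lt_trans (cmod_le_reim _) _.
rewrite creD creN cimD cimN (splitr e) ltrD// distrC.
  by near: n.
by near: n.
Unshelve. all: by end_near. Qed.

(** Quadratic remainder bounds, unlike limits of difference quotients, pass to
limits of sequences of functions. *)
Lemma quad_remainder_derive (f : Cplx R -> Cplx R) z d (e C : R) : 0 < e ->
  (forall w, cmod (w - z) < e -> cmod (f w - f z - (w - z) * d) <= C * cmod (w - z) ^+ 2) ->
  derivable f z 1 /\ derive1 f z = d.
Proof.
move=> e0 H.
have K : h^-1 *: (f (h + z) - f z) @[h --> 0^'] --> d.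
  apply/ccvgP => t t0.
  have C0 : 0 < `|C| + 1 by rewrite ltr_wpDl.
  have m0 : 0 < Num.min e (t / (`|C| + 1)) by rewrite lt_min e0 divr_gt0.
  rewrite near_withinE; apply/cnbhsP; exists (Num.min e (t / (`|C| + 1))) => // h.
  rewrite subr0 lt_min => /andP[he ht] h0.
  have {}H := H (h + z); rewrite addrK in H; have {}H := H he.
  have -> : h^-1 *: (f (h + z) - f z) - d = (f (h + z) - f z - h * d) / h.
    by rewrite /GRing.scale /=; field.
  rewrite cmodf ltr_pdivrMr ?cmod_gt0//; apply: le_lt_trans H _.
  rewrite expr2 mulrA ltr_pM2r ?cmod_gt0//.
  rewrite ltr_pdivlMr// in ht; apply: le_lt_trans ht.
  by rewrite mulrC ler_wpM2l ?cmod_ge0// (le_trans (ler_norm _))// lerDl.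
split; last by rewrite /derive1; apply/cvg_lim => //; exact: norm_hausdorff.
apply/cvg_ex; exists d => /=.
by under eq_fun do rewrite [_ *: 1]mulr1.
Qed.

End ComplexModulus.

(** * A single Blaschke factor *)

Section BlaschkeFactor.
Context {R : realType}.
Implicit Types a z w : Cplx R.

Definition blaschke_den a z : Cplx R := 1 - cconj a * z.

Definition blaschke_phase a : Cplx R := cconj a / cplx (cmod a) 0.

Lemma cmod_den_ge a z : 1 - cmod a * cmod z <= cmod (blaschke_den a z).
Proof. by have := cmod_subl 1 (cconj a * z); rewrite cmod1 cmodM cmod_conj. Qed.

Lemma cmod_den_ge_l a z : cmod a < 1 -> cmod z <= 1 ->
  1 - cmod a <= cmod (blaschke_den a z).
Proof.
move=> a1 z1; apply: le_trans (cmod_den_ge a z); rewrite lerB//.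
by rewrite ler_piMr ?cmod_ge0.
Qed.

Lemma cmod_den_ge_r a z : cmod a < 1 -> 1 - cmod z <= cmod (blaschke_den a z).
Proof.
move=> a1; apply: le_trans (cmod_den_ge a z); rewrite lerB//.
by rewrite ler_piMl ?cmod_ge0 ?ltW.
Qed.

Lemma blaschke_den_neq0 a z : cmod a < 1 -> cmod z < 1 -> blaschke_den a z != 0.
Proof.
move=> a1 z1; rewrite -cmod_gt0; apply: lt_le_trans (cmod_den_ge_r z a1).
by rewrite subr_gt0.
Qed.

Lemma cplx_cmod_neq0 a : 0 < cmod a -> cplx (cmod a) 0 != 0.
Proof. by move=> a0; rewrite -cmod_gt0 cmod_real normr_gt0 gt_eqF. Qed.

Lemma cmod_phase a : 0 < cmod a -> cmod (blaschke_phase a) = 1.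
Proof.
by move=> a0; rewrite /blaschke_phase cmodf cmod_conj cmod_real gtr0_norm// divff// gt_eqF.
Qed.

(** The identity behind the invariance of the hyperbolic metric; it gives both
|b| <= 1 and the Poisson kernel form of 1 - |b|^2. *)
Lemma sqr_cmod_den a z :
  cmod (blaschke_den a z) ^+ 2 - cmod (a - z) ^+ 2 =
  (1 - cmod a ^+ 2) * (1 - cmod z ^+ 2).
Proof.
by rewrite !sqr_cmod /blaschke_den; case: a => x y; case: z => u v /=; ring.
Qed.

Lemma cmod_factor a z : 0 < cmod a ->
  cmod (blaschke_factor a z) = cmod (a - z) / cmod (blaschke_den a z).
Proof. by move=> a0; rewrite [LHS]cmodM cmod_phase// mul1r cmodf. Qed.

Lemma one_sub_sqr_factor a z : 0 < cmod a < 1 -> cmod z < 1 ->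
  1 - cmod (blaschke_factor a z) ^+ 2 =
  (1 - cmod a ^+ 2) * (1 - cmod z ^+ 2) / cmod (blaschke_den a z) ^+ 2.
Proof.
move=> /andP[a0 a1] z1; rewrite -sqr_cmod_den cmod_factor// expr_div_n.
by field; rewrite gt_eqF// cmod_gt0 blaschke_den_neq0.
Qed.

Lemma cmod_factor_le1 a z : 0 < cmod a < 1 -> cmod z < 1 ->
  cmod (blaschke_factor a z) <= 1.
Proof.
move=> a01 z1; rewrite -(@ler_pXn2r _ 2) ?nnegrE ?cmod_ge0// expr1n -subr_ge0.
rewrite one_sub_sqr_factor// divr_ge0 ?sqr_ge0// mulr_ge0// subr_ge0.
  by rewrite expr_le1 ?cmod_ge0// ltW//; case/andP: a01.
by rewrite expr_le1 ?cmod_ge0// ltW.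
Qed.

Lemma cmod_sub_le_den a z : 0 < cmod a < 1 -> cmod z < 1 ->
  cmod (a - z) <= cmod (blaschke_den a z).
Proof.
move=> a01 z1; have := cmod_factor_le1 a01 z1; case/andP: a01 => a0 a1.
by rewrite cmod_factor// ler_pdivrMr ?mul1r// cmod_gt0 blaschke_den_neq0.
Qed.

Definition blaschke_factor' a z : Cplx R :=
  blaschke_phase a * (cplx (cmod a ^+ 2) 0 - 1) / blaschke_den a z ^+ 2.

Lemma factorE a z : blaschke_factor a z = blaschke_phase a * ((a - z) / blaschke_den a z).
Proof. by []. Qed.

Lemma factor_sub a z w : cmod a < 1 -> cmod z < 1 -> cmod w < 1 ->
  blaschke_factor a w - blaschke_factor a z =
  blaschke_phase a * (cplx (cmod a ^+ 2) 0 - 1) * (w - z) /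
    (blaschke_den a w * blaschke_den a z).
Proof.
move=> a1 z1 w1; rewrite -mul_cconj !factorE.
have := blaschke_den_neq0 a1 z1; have := blaschke_den_neq0 a1 w1.
by rewrite /blaschke_den => nw nz; field; rewrite nw nz.
Qed.

Lemma factor_remainder a z w : cmod a < 1 -> cmod z < 1 -> cmod w < 1 ->
  blaschke_factor a w - blaschke_factor a z - (w - z) * blaschke_factor' a z =
  blaschke_phase a * (cplx (cmod a ^+ 2) 0 - 1) * cconj a * (w - z) ^+ 2 /
    (blaschke_den a w * blaschke_den a z ^+ 2).
Proof.
move=> a1 z1 w1; rewrite factor_sub// /blaschke_factor'.
have := blaschke_den_neq0 a1 z1; have := blaschke_den_neq0 a1 w1.
by rewrite /blaschke_den => nw nz; field; rewrite nw nz.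
Qed.

Lemma one_sub_factor a z : 0 < cmod a < 1 -> cmod z < 1 ->
  1 - blaschke_factor a z =
  cplx (1 - cmod a) 0 * (cplx (cmod a) 0 + cconj a * z) / (cplx (cmod a) 0 * blaschke_den a z).
Proof.
move=> /andP[a0 a1] z1; rewrite factorE /blaschke_phase.
have -> : cplx (1 - cmod a) 0 = 1 - cplx (cmod a) 0.
  by apply/eqP; rewrite eq_complex /= subr0 !eqxx.
have E : cconj a * a = cplx (cmod a) 0 ^+ 2.
  by rewrite mulrC mul_cconj; apply/eqP; rewrite eq_complex /=; apply/andP; split; apply/eqP; ring.
have := blaschke_den_neq0 a1 z1; have := cplx_cmod_neq0 a0; rewrite /blaschke_den => n1 n2.
have -> : cconj a / cplx (cmod a) 0 * ((a - z) / (1 - cconj a * z)) =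
  (cconj a * a - cconj a * z) / (cplx (cmod a) 0 * (1 - cconj a * z)).
  by field; rewrite n1 n2.
by rewrite E; field; rewrite n1 n2.
Qed.

Lemma cmod_sqr_sub1 a : 0 < cmod a < 1 ->
  cmod (cplx (cmod a ^+ 2) 0 - 1) <= 2 * (1 - cmod a).
Proof.
move=> /andP[a0 a1].
have -> : cplx (cmod a ^+ 2) 0 - 1 = cplx (cmod a ^+ 2 - 1) 0.
  by apply/eqP; rewrite eq_complex /= subr0 !eqxx.
rewrite cmod_real distrC ger0_norm; last by rewrite subr_ge0 expr_le1 ?ltW.
nra.
Qed.

(** Each of the estimates below carries the factor 1 - |a|, which is what makes
the corresponding sums over the zeros converge. *)
Section Bounds.
Variables (rho : R) (a : Cplx R).
Hypotheses (rho1 : rho < 1) (a01 : 0 < cmod a < 1).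
Let a1 : cmod a < 1. Proof. by case/andP: a01. Qed.
Let a0 : 0 < cmod a. Proof. by case/andP: a01. Qed.
Let s := 1 - rho.
Let s0 : 0 < s. Proof. by rewrite subr_gt0. Qed.

Let den z : cmod z <= rho -> s <= cmod (blaschke_den a z).
Proof. by move=> zr; apply: le_trans (cmod_den_ge_r z a1); rewrite lerB. Qed.

Let denV z : cmod z <= rho -> (cmod (blaschke_den a z))^-1 <= s^-1.
Proof. by move=> zr; rewrite lef_pV2 ?posrE ?den//; apply: lt_le_trans (den zr). Qed.

Let denV0 z : 0 <= (cmod (blaschke_den a z))^-1.
Proof. by rewrite invr_ge0 cmod_ge0. Qed.

Let zlt1 z : cmod z <= rho -> cmod z < 1.
Proof. by move=> /le_lt_trans; apply. Qed.

Lemma cmod_one_sub_factor z : cmod z <= rho ->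
  cmod (1 - blaschke_factor a z) <= 2 * s^-1 * (1 - cmod a).
Proof.
move=> zr; rewrite (one_sub_factor a01 (zlt1 zr)).
rewrite cmodf !cmodM !cmod_real.
rewrite [`|cmod a|]gtr0_norm// gtr0_norm ?subr_gt0//.
have H : cmod (cplx (cmod a) 0 + cconj a * z) <= 2 * cmod a.
  apply: le_trans (cmodD _ _) _; rewrite cmodM cmod_conj cmod_real gtr0_norm//.
  by rewrite mulrDl mul1r lerD2l ler_piMr ?cmod_ge0// ltW// zlt1.
rewrite ler_pdivrMr; last by rewrite mulr_gt0// (lt_le_trans s0)// den.
have D : 1 <= s^-1 * cmod (blaschke_den a z).
  by rewrite mulrC ler_pdivlMr// mul1r den.
apply: le_trans (_ : (1 - cmod a) * (2 * cmod a) * 1 <= _).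
  by rewrite mulr1 ler_wpM2l// subr_ge0 ltW.
have -> : 2 * s^-1 * (1 - cmod a) * (cmod a * cmod (blaschke_den a z)) =
  (1 - cmod a) * (2 * cmod a) * (s^-1 * cmod (blaschke_den a z)) by ring.
by rewrite ler_wpM2l// mulr_ge0 ?subr_ge0 ?ltW// mulr_gt0.
Qed.

Lemma cmod_factor' z : cmod z <= rho ->
  cmod (blaschke_factor' a z) <= 2 * s^-1 ^+ 2 * (1 - cmod a).
Proof.
move=> zr; rewrite /blaschke_factor' cmodf cmodM cmod_phase// mul1r.
rewrite expr2 cmodM invfM.
apply: le_trans (_ : 2 * (1 - cmod a) * (s^-1 * s^-1) <= _); last by rewrite expr2; lra.
apply: ler_pM => //; first exact: cmod_ge0.
- by rewrite mulr_ge0.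
- exact: cmod_sqr_sub1.
- by apply: ler_pM; rewrite ?denV.
Qed.

Lemma cmod_factor_sub z w : cmod z <= rho -> cmod w <= rho ->
  cmod (blaschke_factor a w - blaschke_factor a z) <=
  2 * s^-1 ^+ 2 * (1 - cmod a) * cmod (w - z).
Proof.
move=> zr wr; rewrite (factor_sub a1 (zlt1 zr) (zlt1 wr)).
have := cmod_phase a0; move: (blaschke_phase a) => u hu.
rewrite cmodf !cmodM hu mul1r invfM.
apply: le_trans (_ : 2 * (1 - cmod a) * cmod (w - z) * (s^-1 * s^-1) <= _).
    apply: ler_pM; rewrite ?mulr_ge0 ?cmod_ge0//.
    by rewrite ler_wpM2r ?cmod_ge0 ?cmod_sqr_sub1.
  by apply: ler_pM; rewrite ?denV.
by rewrite expr2; lra.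
Qed.

Lemma cmod_factor_remainder z w : cmod z <= rho -> cmod w <= rho ->
  cmod (blaschke_factor a w - blaschke_factor a z - (w - z) * blaschke_factor' a z) <=
  2 * s^-1 ^+ 3 * (1 - cmod a) * cmod (w - z) ^+ 2.
Proof.
move=> zr wr; rewrite (factor_remainder a1 (zlt1 zr) (zlt1 wr)).
have := cmod_phase a0; move: (blaschke_phase a) => u hu.
rewrite cmodf !cmodM hu mul1r cmod_conj.
rewrite !expr2.
apply: le_trans (_ : 2 * (1 - cmod a) * 1 * (cmod (w - z) * cmod (w - z))
   * (s^-1 * (s^-1 * s^-1)) <= _); last by rewrite !exprS expr0; lra.
rewrite (invfM (cmod (blaschke_den a w))) (invfM (cmod (blaschke_den a z))).
apply: ler_pM; rewrite ?mulr_ge0 ?cmod_ge0//.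
  rewrite ler_wpM2r ?mulr_ge0 ?cmod_ge0//.
  by apply: ler_pM; rewrite ?cmod_ge0 ?cmod_sqr_sub1// ltW.
by apply: ler_pM; rewrite ?mulr_ge0// ?denV//; apply: ler_pM; rewrite ?denV.
Qed.

End Bounds.
End BlaschkeFactor.

(** * The infinite product and its derivative *)

Section ComplexLimits.
Context {R : realType}.

Lemma cvg_cmod (u : nat -> Cplx R) l : u @ \oo --> l -> (fun n => cmod (u n)) @ \oo --> cmod l.
Proof.
move=> ul; apply/cvgrPdist_lt => e e0.
move/ccvgP: ul => /(_ _ e0); apply: filterS => n /=; apply: le_lt_trans.
by rewrite distrC cmod_dist.
Qed.

Lemma cmod_lim_le (u : nat -> Cplx R) l M :
  u @ \oo --> l -> (forall n, cmod (u n) <= M) -> cmod l <= M.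
Proof.
move=> /cvg_cmod ul uM; rewrite -(cvg_lim _ ul)//.
by apply: limr_le; [apply/cvg_ex; eexists; exact: ul|exact: nearW].
Qed.

End ComplexLimits.

(* A factor is itself a product: multiplicativity of cmod must not open it. *)
#[local] Opaque blaschke_factor blaschke_factor'.

Section BlaschkeProduct.
Context {R : realType} (a : nat -> Cplx R).
Hypothesis ha : blaschke_sequence a.

Definition partial_blaschke N z := \prod_(0 <= n < N) blaschke_factor (a n) z.

Fixpoint partial_blaschke' N z : Cplx R :=
  if N is n.+1 then partial_blaschke' n z * blaschke_factor (a n) z +
                    partial_blaschke n z * blaschke_factor' (a n) z
  else 0.

Let a01 n : 0 < cmod (a n) < 1. Proof. by case: ha. Qed.

Lemma partial_blaschkeS N z :
  partial_blaschke N.+1 z = partial_blaschke N z * blaschke_factor (a N) z.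
Proof. by rewrite /partial_blaschke big_nat_recr. Qed.

Lemma partial_blaschke0 z : partial_blaschke 0 z = 1.
Proof. by rewrite /partial_blaschke big_geq. Qed.

Lemma cmod_partial_le1 N z : cmod z < 1 -> cmod (partial_blaschke N z) <= 1.
Proof.
move=> z1; elim: N => [|N IH]; first by rewrite partial_blaschke0 cmod1.
by rewrite partial_blaschkeS cmodM mulr_ile1 ?cmod_ge0 ?cmod_factor_le1.
Qed.

Lemma cmod_partial_le_factor n N z : (n < N)%N -> cmod z < 1 ->
  cmod (partial_blaschke N z) <= cmod (blaschke_factor (a n) z).
Proof.
move=> + z1; elim: N => // N IH; rewrite ltnS leq_eqVlt partial_blaschkeS cmodM.
case/orP => [/eqP ->|/IH {}IH].
  by rewrite ler_piMl ?cmod_ge0 ?cmod_partial_le1.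
by apply: le_trans IH; rewrite ler_piMr ?cmod_ge0 ?cmod_factor_le1.
Qed.

(** For numbers of [0, 1] the defect 1 - t of a product is at most the sum of the
defects, and 1 - t <= 1 - t^2. *)
Lemma one_sub_partial_le N z : cmod z < 1 ->
  1 - cmod (partial_blaschke N z) <=
  \sum_(0 <= n < N) (1 - cmod (blaschke_factor (a n) z) ^+ 2).
Proof.
move=> z1; elim: N => [|N IH]; first by rewrite partial_blaschke0 cmod1 subrr big_geq.
rewrite partial_blaschkeS cmodM big_nat_recr//=.
have P1 := cmod_partial_le1 N z1; have P0 := cmod_ge0 (partial_blaschke N z).
have b1 := cmod_factor_le1 (a01 N) z1; have b0 := cmod_ge0 (blaschke_factor (a N) z).
apply: le_trans (lerD IH (lexx _)); nra.
Qed.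

Definition gap n := 1 - cmod (a n).

Lemma gap_gt0 n : 0 < gap n.
Proof. by rewrite subr_gt0; case/andP: (a01 n). Qed.

Lemma gap_lt1 n : gap n < 1.
Proof. by rewrite ltrBlDr ltrDl; case/andP: (a01 n). Qed.

Lemma cvg_gap : cvgn (series gap). Proof. by case: ha. Qed.

Lemma cvg_gapZ (c : R) : cvgn (series (fun n => c * gap n)).
Proof. exact: (@is_cvg_seriesZ _ gap c cvg_gap). Qed.

Lemma series_gap_le N : series gap N <= limn (series gap).
Proof.
apply: nondecreasing_cvgn_le cvg_gap N; apply/nondecreasing_seqP => n.
by rewrite seriesS lerDr ltW ?gap_gt0.
Qed.

Lemma series_gap_ge0 N : 0 <= series gap N.
Proof. by apply: sumr_ge0 => n _; rewrite ltW ?gap_gt0. Qed.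

Section OnDisc.
Variable rho : R.
Hypothesis rho1 : rho < 1.
Let s0 : 0 < 1 - rho. Proof. by rewrite subr_gt0. Qed.

Lemma unif_factor_bounds : exists2 c : R, 0 < c & forall n z w,
  cmod z <= rho -> cmod w <= rho ->
  [/\ cmod (blaschke_factor (a n) z - 1) <= c * gap n,
      cmod (blaschke_factor' (a n) z) <= c * gap n,
      cmod (blaschke_factor (a n) w - blaschke_factor (a n) z) <=
        c * gap n * cmod (w - z) &
      cmod (blaschke_factor (a n) w - blaschke_factor (a n) z -
            (w - z) * blaschke_factor' (a n) z) <= c * gap n * cmod (w - z) ^+ 2].
Proof.
have [s sV] : exists s, s = (1 - rho)^-1 by exists (1 - rho)^-1.
have sp : 0 < s by rewrite sV invr_gt0.
have [c1 c2 c3] : [/\ 0 <= s, 0 <= s ^+ 2 & 0 <= s ^+ 3].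
  by rewrite ltW// !exprn_ge0// ltW.
exists (2 * s + 2 * s ^+ 2 + 2 * s ^+ 3) => [|n z w zr wr].
  by rewrite !addr_gt0// mulr_gt0// exprn_gt0.
have g0 : 0 <= gap n by rewrite ltW ?gap_gt0.
split.
- rewrite cmodBC; apply: le_trans (cmod_one_sub_factor rho1 (a01 n) zr) _.
  by rewrite -sV ler_wpM2r// -addrA lerDl addr_ge0// mulr_ge0.
- apply: le_trans (cmod_factor' rho1 (a01 n) zr) _.
  by rewrite -sV ler_wpM2r// addrAC lerDr addr_ge0// mulr_ge0.
- apply: le_trans (cmod_factor_sub rho1 (a01 n) zr wr) _.
  by rewrite -sV ler_wpM2r ?cmod_ge0// ler_wpM2r// addrAC lerDr addr_ge0// mulr_ge0.
- apply: le_trans (cmod_factor_remainder rho1 (a01 n) zr wr) _.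
  by rewrite -sV ler_wpM2r ?sqr_ge0// ler_wpM2r// lerDr addr_ge0// mulr_ge0.
Qed.

Lemma cmod_partial'_le (c : R) N z : cmod z < 1 ->
  (forall n, cmod (blaschke_factor' (a n) z) <= c * gap n) ->
  cmod (partial_blaschke' N z) <= c * series gap N.
Proof.
move=> z1 H; elim: N => [|N IH]; first by rewrite cmod0 /series /= big_geq// mulr0.
rewrite seriesS mulrDr addrC /=; apply: le_trans (cmodD _ _) _.
rewrite (cmodM (partial_blaschke' _ _)) (cmodM (partial_blaschke _ _)).
apply: lerD.
  by apply: le_trans IH; rewrite ler_piMr ?cmod_ge0 ?cmod_factor_le1.
by apply: le_trans (H N); rewrite ler_piMl ?cmod_ge0 ?cmod_partial_le1.
Qed.

Lemma cvg_partial_blaschke z : cmod z <= rho ->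
  cvgn (partial_blaschke ^~ z) /\ cvgn (partial_blaschke' ^~ z).
Proof.
move=> zr; have z1 := le_lt_trans zr rho1.
have [c c0 H] := unif_factor_bounds.
have D N : cmod (partial_blaschke' N z) <= c * series gap N.
  by apply: cmod_partial'_le => // n; have [] := H n z z zr zr.
split.
  apply: (@csummable_cvg _ _ (fun n => c * gap n)) => [n|].
    have [Hb _ _ _] := H n z z zr zr.
    have -> : partial_blaschke n.+1 z - partial_blaschke n z =
      partial_blaschke n z * (blaschke_factor (a n) z - 1).
      by rewrite partial_blaschkeS mulrBr mulr1.
    by rewrite cmodM; apply: le_trans Hb; rewrite ler_piMl ?cmod_ge0 ?cmod_partial_le1.
  exact: cvg_gapZ.
apply: (@csummable_cvg _ _ (fun n => (c * limn (series gap) * c + c) * gap n)) => [n|].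
  have [Hb Hd _ _] := H n z z zr zr.
  have -> : partial_blaschke' n.+1 z - partial_blaschke' n z =
    partial_blaschke' n z * (blaschke_factor (a n) z - 1) +
    partial_blaschke n z * blaschke_factor' (a n) z by rewrite /=; ring.
  apply: le_trans (cmodD _ _) _; rewrite mulrDl.
  rewrite (cmodM (partial_blaschke' _ _)) (cmodM (partial_blaschke _ _)); apply: lerD.
    rewrite -[leRHS]mulrA; apply: ler_pM; rewrite ?cmod_ge0//.
    exact: le_trans (D n) (ler_wpM2l (ltW c0) (series_gap_le n)).
  by apply: le_trans Hd; rewrite ler_piMl ?cmod_ge0 ?cmod_partial_le1.
exact: cvg_gapZ.
Qed.

(** The constant does not depend on the number of factors: this is what lets the
first order expansion survive the passage to the infinite product. *)
Lemma partial_blaschke_remainder : exists C : R, forall N z w,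
  cmod z <= rho -> cmod w <= rho ->
  cmod (partial_blaschke N w - partial_blaschke N z - (w - z) * partial_blaschke' N z)
    <= C * cmod (w - z) ^+ 2.
Proof.
have [c c0 H] := unif_factor_bounds.
set S := c * limn (series gap).
exists ((1 + S) * S) => N z w zr wr.
have z1 := le_lt_trans zr rho1; have w1 := le_lt_trans wr rho1.
have S0 : 0 <= S.
  by apply: mulr_ge0; [exact: ltW|exact: le_trans (series_gap_ge0 0) (series_gap_le 0)].
have D K : cmod (partial_blaschke' K z) <= c * series gap K.
  by apply: cmod_partial'_le => // n; have [] := H n z z zr zr.
have DS K : cmod (partial_blaschke' K z) <= S.
  exact: le_trans (D K) (ler_wpM2l (ltW c0) (series_gap_le K)).
apply: (@le_trans _ _ ((1 + S) * (c * series gap N) * cmod (w - z) ^+ 2)); last first.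
  rewrite ler_wpM2r ?sqr_ge0// ler_wpM2l ?addr_ge0//.
  by apply: ler_wpM2l; [exact: ltW|exact: series_gap_le].
elim: N => [|N IH].
  rewrite !partial_blaschke0 subrr mulr0 subr0 cmod0.
  by rewrite !mulr_ge0 ?addr_ge0 ?series_gap_ge0// ?cmod_ge0// ltW.
have [_ _ Hs Hr] := H N z w zr wr.
(* expansion of a product: remainder of the first factor, remainder of the
   second, and the cross term of the two first order increments *)
rewrite !partial_blaschkeS /=.
set P := partial_blaschke N; set P' := partial_blaschke' N z.
set b := blaschke_factor (a N); set b' := blaschke_factor' (a N) z.
have -> : P w * b w - P z * b z - (w - z) * (P' * b z + P z * b') =
  (P w - P z - (w - z) * P') * b w +
  P z * (b w - b z - (w - z) * b') + (w - z) * P' * (b w - b z) by ring.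
have -> : (1 + S) * (c * series gap N.+1) * cmod (w - z) ^+ 2 =
  (1 + S) * (c * series gap N) * cmod (w - z) ^+ 2 +
  (1 + S) * (c * gap N) * cmod (w - z) ^+ 2 by rewrite seriesS; ring.
rewrite -addrA.
apply: le_trans (cmodD _ _) _; apply: lerD.
  apply: le_trans IH; rewrite cmodM ler_piMr ?cmod_ge0//.
  exact: cmod_factor_le1.
apply: le_trans (cmodD _ _) _; rewrite !cmodM.
have -> : (1 + S) * (c * gap N) * cmod (w - z) ^+ 2 = c * gap N * cmod (w - z) ^+ 2 +
  cmod (w - z) * S * (c * gap N * cmod (w - z)) by ring.
apply: lerD.
  by apply: le_trans Hr; rewrite ler_piMl ?cmod_ge0 ?cmod_partial_le1.
apply: ler_pM; rewrite ?mulr_ge0 ?cmod_ge0//.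
by apply: ler_wpM2l (DS N); exact: cmod_ge0.
Qed.

End OnDisc.

Let inner z : cmod z < 1 -> exists2 r : R, r < 1 & cmod z <= r.
Proof. by move=> z1; exists (cmod z). Qed.

Lemma cvg_blaschke z : cmod z < 1 -> partial_blaschke ^~ z @ \oo --> blaschke a z.
Proof.
case/inner => r r1 zr; have [H _] := cvg_partial_blaschke r1 zr.
rewrite /blaschke; exact: H.
Qed.

Lemma blaschke_quad rho : rho < 1 -> exists C : R, forall z w,
  cmod z <= rho -> cmod w <= rho ->
  cmod (blaschke a w - blaschke a z - (w - z) * limn (partial_blaschke' ^~ z))
    <= C * cmod (w - z) ^+ 2.
Proof.
move=> r1; have [C HC] := partial_blaschke_remainder r1; exists C => z w zr wr.
apply: (@cmod_lim_le _ (fun N => partial_blaschke N w - partial_blaschke N z -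
  (w - z) * partial_blaschke' N z)) => [|N]; last exact: HC.
apply: cvgB; first apply: cvgB.
- by apply: cvg_blaschke; apply: le_lt_trans r1.
- by apply: cvg_blaschke; apply: le_lt_trans r1.
- apply: cvgM; first exact: cvg_cst.
  by case: (cvg_partial_blaschke r1 zr).
Qed.

Lemma blaschke_derive z : cmod z < 1 ->
  derive1 (blaschke a) z = limn (partial_blaschke' ^~ z).
Proof.
move=> z1; have [r /andP[zr r1]] : exists r, cmod z < r < 1.
  by exists ((cmod z + 1) / 2); rewrite midf_lt//=; rewrite midf_lt.
have [C HC] := blaschke_quad r1.
have e0 : 0 < r - cmod z by rewrite subr_gt0.
apply: (proj2 (@quad_remainder_derive _ _ _ _ _ C e0 _)) => w wz; apply: HC.
  exact: ltW.
rewrite -(subrK z w); apply: le_trans (cmodD _ _) _; rewrite addrC -lerBrDl; exact: ltW.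
Qed.

Lemma blaschke_remainder rho : rho < 1 -> exists C : R, forall z w,
  cmod z <= rho -> cmod w <= rho ->
  cmod (blaschke a w - blaschke a z - (w - z) * derive1 (blaschke a) z)
    <= C * cmod (w - z) ^+ 2.
Proof.
move=> r1; have [C HC] := blaschke_quad r1; exists C => z w zr wr.
by rewrite blaschke_derive; [exact: HC|exact: le_lt_trans r1].
Qed.

(** Exchanging the two points in the first order expansion compares the
derivatives at them. *)
Lemma blaschke'_lipschitz rho : rho < 1 -> exists C : R, forall z w,
  cmod z <= rho -> cmod w <= rho ->
  cmod (derive1 (blaschke a) w - derive1 (blaschke a) z) <= C * cmod (w - z).
Proof.
move=> r1; have [C HC] := blaschke_remainder r1; exists (C + C) => z w zr wr.
have [->|wz] := eqVneq w z; first by rewrite !subrr cmod0 mulr0.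
have wz0 : 0 < cmod (w - z) by rewrite cmod_gt0 subr_eq0.
rewrite -(ler_pM2l wz0) -cmodM [leRHS]mulrCA -expr2 (mulrDl C C).
have := HC z w zr wr; have := HC w z wr zr; rewrite (cmodBC z w).
move: (derive1 _ w) (derive1 _ z) (blaschke a z) (blaschke a w) => dw dz bz bw h1 h2.
have -> : (w - z) * (dw - dz) = (bz - bw - (z - w) * dw) + (bw - bz - (w - z) * dz).
  by ring.
by apply: le_trans (cmodD _ _) _; apply: lerD.
Qed.

Lemma cmod_blaschke_le_factor n z : cmod z < 1 ->
  cmod (blaschke a z) <= cmod (blaschke_factor (a n) z).
Proof.
move=> z1; have ul := cvg_cmod (cvg_blaschke z1); rewrite -(cvg_lim _ ul)//.
apply: limr_le; first by apply/cvg_ex; eexists; exact: ul.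
near=> N; apply: cmod_partial_le_factor => //; near: N; exact: nbhs_infty_gt.
Unshelve. all: by end_near. Qed.

End BlaschkeProduct.

(** * Open sets and iterated integrals in the plane *)

Section PlaneMeasure.
Context {R : realType}.
Local Notation mR := (measurableTypeR R).
Local Notation leb := (@lebesgue_measure R).
Local Notation leb2 := (@product_measure1 _ _ _ _ _ leb leb).

Definition box_open (O : set (mR * mR)) := forall x y, O (x, y) ->
  exists2 e : R, 0 < e &
    forall x' y', `|x' - x| < e -> `|y' - y| < e -> O (x', y').

(** The product sigma-algebra contains the open sets because an open set is the
union of the boxes with rational centre and radius that it contains. *)
Lemma box_open_measurable (O : set (mR * mR)) : box_open O -> measurable O.
Proof.
move=> bO.
pose box (q : rat * rat * rat) : set (mR * mR) :=
  `](ratr q.1.1 - ratr q.2)%R, (ratr q.1.1 + ratr q.2)%R[%classic `*`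
  `](ratr q.1.2 - ratr q.2)%R, (ratr q.1.2 + ratr q.2)%R[%classic.
have -> : O = \bigcup_q [set w | box q w /\ box q `<=` O].
  apply/seteqP; split => [[x y] Oxy|w [q _] [bw]]; last exact.
  have [e e0 He] := bO _ _ Oxy.
  have [r /[!in_itv]/= /andP[r0 re]] : exists q : rat, ratr q \in `]0, e / 2[.
    by apply: rat_in_itvoo; rewrite divr_gt0.
  have [q1 /[!in_itv]/= /andP[a1 b1]] : exists q : rat, ratr q \in `]x - ratr r, x + ratr r[.
    by apply: rat_in_itvoo; lra.
  have [q2 /[!in_itv]/= /andP[a2 b2]] : exists q : rat, ratr q \in `]y - ratr r, y + ratr r[.
    by apply: rat_in_itvoo; lra.
  exists (q1, q2, r) => //.
  have boxO : box (q1, q2, r) `<=` O.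
    case=> x' y' [] /=; rewrite !in_itv/= => /andP[c1 d1] /andP[c2 d2].
    by apply: He; rewrite ltr_norml; lra.
  by split=> //; split; rewrite /= in_itv/=; lra.
apply: countable_bigcupT_measurable => // q.
have [bO'|bO'] := pselect (box q `<=` O); last first.
  by rewrite (_ : [set _ | _] = set0)//; apply/seteqP; split=> // w [].
rewrite (_ : [set _ | _] = box q); last by apply/seteqP; split=> // w [].
by apply: measurableX; apply: measurable_itv.
Qed.

Lemma box_continuous_measurable (D : set (mR * mR)) (f : mR * mR -> R) :
  box_open D ->
  (forall x y, D (x, y) -> forall e : R, 0 < e -> exists2 d : R, 0 < d &
    forall x' y', D (x', y') -> `|x' - x| < d -> `|y' - y| < d ->
      `|f (x', y') - f (x, y)| < e) ->
  measurable_fun D f.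
Proof.
move=> bD cf mD; apply: (measurability _ (RGenOInfty.measurableE R)) => //.
move=> _ [_ [t ->] <-]; apply: box_open_measurable => x y [Dxy] /=.
rewrite in_itv/= andbT => ft.
have [d1 d10 H1] := bD _ _ Dxy.
have e0 : 0 < f (x, y) - t by rewrite subr_gt0.
have [d2 d20 H2] := cf _ _ Dxy _ e0.
exists (Num.min d1 d2) => [|x' y']; first by rewrite lt_min d10.
rewrite !lt_min => /andP[x1 x2] /andP[y1 y2].
have D' := H1 _ _ x1 y1; split => //=; rewrite in_itv/= andbT.
by have := H2 _ _ D' x2 y2; rewrite ltr_norml => /andP[+ _]; lra.
Qed.

(** Lebesgue measure is characterized by its values on half-open intervals, and
reflection only exchanges their closed and open ends. *)
Lemma integral_reflect (f : mR -> \bar R) : measurable_fun setT f ->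
  (forall x, 0 <= f x)%E ->
  (\int[leb]_x f (- x)%R = \int[leb]_x f x)%E.
Proof.
move=> mf f0.
have mopp : measurable_fun [set: mR] (fun x : mR => (- x)%R : mR).
  exact: measurableT_comp.
have E A : measurable A -> leb A = pushforward leb (fun x : mR => (- x)%R : mR) A.
  move=> mA.
  pose nu : {measure set mR -> \bar R} :=
    measure_function_pushforward__canonical__measure_function_Measure leb mopp.
  apply: (@lebesgue_measure_unique R nu) => // X [[a b] _ <-] /=.
  rewrite /pushforward (_ : _ @^-1` _ = `[- b, - a[%classic); last first.
    by apply/seteqP; split=> x /=; rewrite !in_itv/= lerNl ltrNr => /andP[-> ->].
  by rewrite !lebesgue_measure_itv/= !lte_fin ltrN2; case: ifP => // _; rewrite -!EFinD opprK addrC.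
have := @ge0_integral_pushforward _ _ _ _ _ _ mopp leb setT f measurableT mf (fun y _ => f0 y).
rewrite preimage_setT => <-.
by apply: eq_measure_integral => A mA _; exact/esym/E.
Qed.

Section Frames.
Variable G : mR * mR -> \bar R.
Hypotheses (mG : measurable_fun setT G) (G0 : forall w, (0 <= G w)%E).

Let mGx (x : mR) : measurable_fun setT (fun y : mR => G (x, y)).
Proof. exact: measurableT_comp mG (measurable_pair1 x). Qed.

Let mGy (y : mR) : measurable_fun setT (fun x : mR => G (x, y)).
Proof. exact: measurableT_comp mG (measurable_pair2 y). Qed.

Lemma tonelli_xy : (\int[leb]_x \int[leb]_y G (x, y) = \int[leb2]_w G w)%E.
Proof. by rewrite fubini_tonelli1. Qed.

Lemma tonelli_yx : (\int[leb]_y \int[leb]_x G (x, y) = \int[leb2]_w G w)%E.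
Proof. by rewrite -tonelli_xy -(fubini_tonelli (m1 := leb) (m2 := leb) G mG G0). Qed.

Lemma tonelli_NxNy :
  (\int[leb]_x \int[leb]_y G (- x, - y)%R = \int[leb2]_w G w)%E.
Proof.
under eq_integral => x _ do rewrite (integral_reflect (mGx _) (fun=> G0 _)).
rewrite (integral_reflect (f := fun x => (\int[leb]_y G (x, y))%E)) ?tonelli_xy//.
  exact: (measurable_fun_fubini_tonelli_F (m2 := leb) G).
by move=> x; apply: integral_ge0 => y _.
Qed.

Lemma tonelli_Nyx : (\int[leb]_x \int[leb]_y G (- y, x)%R = \int[leb2]_w G w)%E.
Proof.
under eq_integral => x _ do rewrite (integral_reflect (mGy _) (fun=> G0 _)).
exact: tonelli_yx.
Qed.

Lemma tonelli_yNx : (\int[leb]_x \int[leb]_y G (y, - x)%R = \int[leb2]_w G w)%E.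
Proof.
rewrite (integral_reflect (f := fun x => (\int[leb]_y G (y, x))%E)) ?tonelli_yx//.
  exact: (measurable_fun_fubini_tonelli_G (m1 := leb) G).
by move=> x; apply: integral_ge0 => y _.
Qed.

End Frames.
End PlaneMeasure.

(** * Real-variable inequalities *)

Section GeometricCluster.
Context {R : realType} (I : eqType) (u : I -> R) (q U : R).
Hypotheses (q0 : 0 <= q) (q1 : q < 1).

(** Remove the largest term: each of the others is at most q times it. *)
Lemma cluster_sum_le (s : seq I) : uniq s -> 0 <= U ->
  {in s, forall i, 0 <= u i <= U} ->
  {in s &, forall i j, i != j -> u i <= q * u j \/ u j <= q * u i} ->
  \sum_(i <- s) u i <= U / (1 - q).
Proof.
have q1' : 0 < 1 - q by rewrite subr_gt0.
have [n] := ubnP (size s); elim: n s U => // n IH [|i0 s0] V sn us V0 uV usep.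
  by rewrite big_nil divr_ge0 // ltW.
set s := i0 :: s0 in sn us uV usep *.
have [m ms umax] : exists2 m, m \in s & {in s, forall j, u j <= u m}.
  have [k _ kmax] := @arg_maxP _ _ _ (ord0 : 'I_(size s)) xpredT
    (fun k : 'I_(size s) => u (nth i0 s k)) isT.
  exists (nth i0 s k); first exact: mem_nth.
  by move=> j js; have := kmax (Ordinal (etrans (index_mem _ _) js)) isT; rewrite /= nth_index.
have /andP[um0 umV] := uV _ ms.
rewrite (big_rem m)//.
have mem_s j : j \in rem m s -> j \in s /\ j != m.
  by rewrite mem_rem_uniq// inE => /andP[].
have H : \sum_(j <- rem m s) u j <= q * u m / (1 - q).
  apply: IH; rewrite ?rem_uniq//.
  - by rewrite size_rem//=; rewrite ltnS in sn.
  - exact: mulr_ge0.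
  - move=> j /mem_s[js jm]; have /andP[-> _] /= := uV _ js.
    have [//|H] := usep _ _ js ms jm.
    exact: le_trans (umax _ js) (le_trans H (ler_wpM2l q0 (umax _ js))).
  - by move=> i j /mem_s[si _] /mem_s[sj _]; exact: usep.
apply: le_trans (lerD (lexx _) H) _.
rewrite ler_pdivlMr// mulrDl mulfVK ?gt_eqF//; lra.
Qed.

End GeometricCluster.

Section RealAnalysis.
Context {R : realType}.
Local Notation mR := (measurableTypeR R).
Local Notation leb := (@lebesgue_measure R).

Lemma quad_remainder_is_derive (f : R -> R) (x d e C : R) : 0 < e ->
  (forall t, `|t - x| < e -> `|f t - f x - (t - x) * d| <= C * (t - x) ^+ 2) ->
  is_derive x 1 f d.
Proof.
move=> e0 H.
have K : h^-1 *: (f (h + x) - f x) @[h --> 0^'] --> d.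
  apply/cvgrPdist_lt => t t0.
  have C0 : 0 < `|C| + 1 by rewrite ltr_wpDl.
  have m0 : 0 < Num.min e (t / (`|C| + 1)) by rewrite lt_min e0 divr_gt0.
  rewrite near_withinE; apply/nbhs_ballP; exists (Num.min e (t / (`|C| + 1))) => // h.
  rewrite /ball/= sub0r normrN lt_min => /andP[he ht] h0.
  have {}H := H (h + x); rewrite addrK in H; have {}H := H he.
  rewrite distrC.
  have -> : h^-1 *: (f (h + x) - f x) - d = (f (h + x) - f x - h * d) / h.
    by rewrite /GRing.scale /=; field.
  rewrite normrM normfV ltr_pdivrMr ?normr_gt0//; apply: le_lt_trans H _.
  rewrite ltr_pdivlMr// in ht.
  rewrite -(real_normK (num_real h)) expr2 mulrA ltr_pM2r ?normr_gt0//.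
  apply: le_lt_trans ht; rewrite mulrC ler_wpM2l//.
  by rewrite (le_trans (ler_norm _))// lerDl.
have D : derivable f x 1.
  by apply/cvg_ex; exists d => /=; under eq_fun do rewrite [_ *: 1]mulr1.
apply: DeriveDef => //.
by rewrite -derive1E /derive1; apply/cvg_lim.
Qed.

Section FTC.
Variables (F f : R -> R) (a b : R).
Hypotheses (ab : a < b)
  (dF : forall y, a <= y <= b -> is_derive y 1 F (f y))
  (cf : forall y, a <= y <= b -> {for y, continuous f}).

Lemma FTC_within : {within `[a, b], continuous f}.
Proof.
by apply: continuous_in_subspaceT => y; rewrite inE/= in_itv/= => /cf.
Qed.

Lemma FTC_is_derive :
  (\int[leb]_(y in `[a, b]) (f y)%:E = (F b - F a)%:E)%E.
Proof.
have cF y : a <= y <= b -> F x @[x --> y] --> F y.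
  move=> yab; apply: differentiable_continuous; apply/derivable1_diffP.
  by case: (dF yab).
rewrite EFinB; apply: continuous_FTC2 ab FTC_within _ _.
  split; first by move=> y /[!in_itv]/= /andP[y1 y2]; case: (dF (y := y)) => //; rewrite !ltW.
  - by apply: cvg_at_right_filter; apply: cF; rewrite lexx ltW.
  - by apply: cvg_at_left_filter; apply: cF; rewrite lexx ltW.
move=> y /[!in_itv]/= /andP[y1 y2]; rewrite derive1E.
have yab : a <= y <= b by rewrite !ltW.
by have [_ ->] := dF yab.
Qed.

(** The integral of k may be infinite, so the comparison goes through the positive
part of f. *)
Lemma FTC_is_derive_le (k : R -> R) : measurable_fun (`[a, b] : set mR) k ->
  (forall y, a <= y <= b -> 0 <= k y) -> (forall y, a <= y <= b -> f y <= k y) ->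
  ((F b - F a)%:E <= \int[leb]_(y in `[a, b]) (k y)%:E)%E.
Proof.
move=> mk k0 fk; rewrite -FTC_is_derive.
have mf : measurable_fun (`[a, b] : set mR) (EFin \o f).
  apply/measurable_EFinP; apply: subspace_continuous_measurable_fun => //.
  exact: FTC_within.
rewrite integralE.
apply: (@le_trans _ _ (\int[leb]_(x in `[a, b]) ((EFin \o f)^\+ x)%E)%E).
  by rewrite -[leRHS]adde0 leeD2l// oppe_le0 integral_ge0.
apply: ge0_le_integral => //.
- exact: measurable_funepos.
- exact/measurable_EFinP.
- move=> y /=; rewrite in_itv/= => yab.
  by rewrite funeposE /= ge_max lee_fin fk//= lee_fin k0.
Qed.

End FTC.

(** The bound does not depend on s: the kernel has the primitive atan ((x - t) / s). *)
Lemma integral_poisson_le (s t : R) : 0 < s ->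
  (\int[leb]_(x in `[(-1)%R, 1%R]) (s / (s ^+ 2 + (x - t) ^+ 2))%:E <= pi%:E)%E.
Proof.
move=> s0.
have p0 x : 0 < s ^+ 2 + (x - t) ^+ 2 by rewrite ltr_pwDl ?sqr_ge0 ?exprn_gt0.
have dF (x : R) : -1 <= x <= 1 ->
    is_derive x 1 (fun x => atan ((x - t) / s)) (s / (s ^+ 2 + (x - t) ^+ 2)).
  move=> _.
  have H : is_derive x 1 (fun x => (x - t) / s) s^-1.
    have -> : (fun x => (x - t) / s) = s^-1 \*: (id - cst t).
      by apply/funext => y /=; rewrite /GRing.scale /= mulrC.
    by apply: is_derive_eq; rewrite subr0 /GRing.scale /= mulr1.
  have := @is_derive1_comp _ _ _ x _ _ (is_derive1_atan ((x - t) / s)) H.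
  rewrite /comp; congr is_derive; rewrite expr_div_n.
  have -> : 1 + (x - t) ^+ 2 / s ^+ 2 = (s ^+ 2 + (x - t) ^+ 2) / s ^+ 2.
    by field; rewrite gt_eqF.
  by field; rewrite !gt_eqF.
have cf (x : R) : -1 <= x <= 1 -> {for x, continuous (fun x => s / (s ^+ 2 + (x - t) ^+ 2))}.
  move=> _; apply: cvgM; first exact: cvg_cst.
  apply: cvgV; first by rewrite gt_eqF.
  apply: cvgD; first exact: cvg_cst.
  apply: (@cvg_comp _ _ _ (fun x => x - t) (fun x => x ^+ 2)); last exact: exprn_continuous.
  by apply: cvgB; [exact: cvg_id|exact: cvg_cst].
have lt11 : -1 < 1 :> R by lra.
rewrite (FTC_is_derive lt11 dF cf).
rewrite lee_fin.
have := atan_ltpi2 ((1 - t) / s); have := atan_gtNpi2 ((- 1 - t) / s); lra.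
Qed.

(** Young's inequality, up to constants: either g is below the threshold or its
p-th power pays for it. *)
Lemma young_threshold (g l p : R) : 0 <= g -> 0 < l -> 1 < p ->
  g <= l `^ (p - 1) * g `^ p + l^-1.
Proof.
move=> g0 l0 p1.
have [gl|gl] := leP g l^-1.
  by rewrite (le_trans gl)// lerDr mulr_ge0 ?powR_ge0.
have gp : 0 < g by apply: lt_trans gl; rewrite invr_gt0.
apply: (@le_trans _ _ (l `^ (p - 1) * g `^ p)); last by rewrite lerDl invr_ge0 ltW.
rewrite -(@mulr_powRB1 _ g p) ?(lt_trans ltr01 p1)//.
have lg : 1 <= l * g by rewrite mulrC -ler_pdivrMr// mul1r ltW.
rewrite mulrCA -powRM// ?(ltW l0)// ler_peMr//.
by rewrite -[leLHS](powRr0 (l * g)) ler_powR// subr_ge0 ltW.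
Qed.

End RealAnalysis.

(** * Growth of the product along a vertical segment *)

Section VerticalLine.
Context {R : realType} (a : nat -> Cplx R).
Hypothesis ha : blaschke_sequence a.
Local Notation mR := (measurableTypeR R).
Local Notation leb := (@lebesgue_measure R).
Local Notation B := (blaschke a).
Local Notation B' := (derive1 (blaschke a)).

Lemma lipschitz_at_continuous (f : R -> R) (y e C : R) : 0 < e ->
  (forall t, `|t - y| < e -> `|f t - f y| <= C * `|t - y|) -> {for y, continuous f}.
Proof.
move=> e0 H; apply/cvgrPdist_lt => d d0.
have C0 : 0 < `|C| + 1 by rewrite ltr_wpDl.
apply/nbhs_ballP; exists (Num.min e (d / (`|C| + 1))) => /=.
  by rewrite lt_min e0 divr_gt0.
move=> t; rewrite /ball/= distrC lt_min => /andP[te td].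
rewrite distrC; apply: le_lt_trans (H t te) _.
rewrite ltr_pdivlMr// in td; apply: le_lt_trans td.
rewrite mulrC ler_wpM2l//; apply: le_trans (ler_norm _) _; by rewrite lerDl.
Qed.

(** The quantity 1 - |z|^2 replaces the distance to the circle: its derivative
along a vertical line is - 2 y, which is at most - 1 where y >= 1/2. *)
Definition depth (x y : R) := 1 - x ^+ 2 - y ^+ 2.

Lemma depthE (x y : R) : depth x y = 1 - cmod (cplx x y) ^+ 2.
Proof. by rewrite sqr_cmod /depth /=; ring. Qed.

Lemma depth_gt0 (x y : R) : (0 < depth x y) = (cmod (cplx x y) < 1).
Proof. by rewrite depthE subr_gt0 expr_lt1// cmod_ge0. Qed.

Lemma depth_le (x y y' : R) : 0 <= y <= y' -> depth x y' <= depth x y.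
Proof. by move=> yy'; rewrite /depth; nra. Qed.

Lemma near_line (x y : R) : 0 < depth x y -> exists rho e : R,
  [/\ rho < 1, 0 < e, cmod (cplx x y) <= rho &
    forall t, `|t - y| < e -> cmod (cplx x t) <= rho].
Proof.
rewrite depth_gt0 => z1; set z := cplx x y in z1 *.
exists ((cmod z + 1) / 2), ((1 - cmod z) / 2); split; [lra|lra|lra|move=> t ty].
have -> : cplx x t = z + cplx 0 (t - y).
  by rewrite /z cplxD addr0 addrC subrK.
apply: le_trans (cmodD _ _) _.
rewrite cmod_imag; lra.
Qed.

Lemma vertical_sub (x y t : R) : cplx x t - cplx x y = cplx (t - y) 0 * cplx 0 1.
Proof.
by apply/eqP; rewrite eq_complex /=; apply/andP; split; apply/eqP; ring.
Qed.

Lemma cmod_vertical_sub (x y t : R) : cmod (cplx x t - cplx x y) = `|t - y|.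
Proof.
by rewrite vertical_sub cmodM cmod_real cmod_imag normr1 mulr1.
Qed.

Lemma cre_realM (s : R) (w : Cplx R) : cre (cplx s 0 * w) = s * cre w.
Proof. by case: w => u v; rewrite /= mul0r subr0. Qed.

Lemma blaschke_line_derive (c : Cplx R) (x y : R) : 0 < depth x y ->
  is_derive y 1 (fun t => cre (c * B (cplx x t))) (cre (c * (cplx 0 1 * B' (cplx x y)))).
Proof.
case/near_line => rho [e [r1 e0 zr tr]].
have [C HC] := blaschke_remainder ha r1.
apply: (@quad_remainder_is_derive _ _ _ _ e (cmod c * C)) => // t te.
have := HC _ _ zr (tr _ te); rewrite cmod_vertical_sub vertical_sub.
move: (B' _) (B (cplx x y)) (B (cplx x t)) => d bz bw H.
have -> : cre (c * bw) - cre (c * bz) - (t - y) * cre (c * (cplx 0 1 * d)) =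
  cre (c * (bw - bz - cplx (t - y) 0 * cplx 0 1 * d)).
  rewrite -cre_realM -!creN -!creD; congr cre; ring.
apply: le_trans (cre_le _) _; rewrite cmodM -[leRHS]mulrA -[(t - y) ^+ 2]real_normK ?num_real//.
by rewrite ler_wpM2l ?cmod_ge0.
Qed.

Lemma blaschke'_line_lipschitz (x y : R) : 0 < depth x y -> exists e C : R,
  0 < e /\ forall t, `|t - y| < e ->
    cmod (B' (cplx x t) - B' (cplx x y)) <= C * `|t - y|.
Proof.
case/near_line => rho [e [r1 e0 zr tr]].
have [C HC] := blaschke'_lipschitz ha r1; exists e, C; split=> // t te.
by have := HC _ _ zr (tr _ te); rewrite cmod_vertical_sub.
Qed.

Lemma blaschke'_line_continuous (c : Cplx R) (x y : R) : 0 < depth x y ->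
  {for y, continuous (fun t => cre (c * (cplx 0 1 * B' (cplx x t))))}.
Proof.
case/blaschke'_line_lipschitz => e [C [e0 H]].
apply: (@lipschitz_at_continuous _ _ e (cmod c * C)) => // t te.
rewrite -creN -creD -mulrBr -mulrBr; apply: le_trans (cre_le _) _.
rewrite !cmodM cmod_imag normr1 mul1r -mulrA.
by rewrite ler_wpM2l ?cmod_ge0 ?H.
Qed.

Lemma cmod_blaschke'_line_continuous (x y : R) : 0 < depth x y ->
  {for y, continuous (fun t => cmod (B' (cplx x t)))}.
Proof.
case/blaschke'_line_lipschitz => e [C [e0 H]].
apply: (@lipschitz_at_continuous _ _ e C) => // t te.
exact: le_trans (cmod_dist _ _) (H t te).
Qed.

Lemma measurable_depth (x : R) (D : set mR) : measurable_fun D (depth x).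
Proof.
apply: measurable_funS (@measurableT _ mR) (@subsetT _ _) _.
apply: continuous_measurable_fun => y; apply: cvgB; first exact: cvg_cst.
exact: exprn_continuous.
Qed.

Lemma measurable_blaschke'_line (x y0 y1 : R) : 0 <= y0 -> 0 < depth x y1 ->
  measurable_fun (`[y0, y1]%classic : set mR) (fun y => cmod (B' (cplx x y))).
Proof.
move=> y00 d1; apply: subspace_continuous_measurable_fun => //.
apply: continuous_in_subspaceT => y; rewrite inE/= in_itv/= => /andP[h1 h2].
apply: cmod_blaschke'_line_continuous; apply: lt_le_trans d1 _.
by apply: depth_le; rewrite (le_trans y00).
Qed.

Variable p : R.
Hypothesis hp : 1 < p < 2.
Let p1 : 1 < p. Proof. by case/andP: hp. Qed.
Let p2 : p < 2. Proof. by case/andP: hp. Qed.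

Definition half_exp := 2^-1 * (p - 1).

(** The threshold for |B'| is the inverse of 16 (h depth)^(1/2): it is dominated by
the derivative of - depth^(1/2) / (8 h^(1/2)), which contributes at most 1/4 over
the whole segment. *)
Lemma segment_energy_ge (x y0 y1 h : R) : 0 < h -> 2^-1 <= y0 <= y1 ->
  0 < depth x y1 -> depth x y0 <= 4 * h ->
  ((cmod (B (cplx x y1)) - cmod (B (cplx x y0)) - 4^-1)%:E <=
   \int[leb]_(y in `[y0, y1])
     (16 * (h * depth x y) `^ half_exp * cmod (B' (cplx x y)) `^ p)%:E)%E.
Proof.
move=> h0 /andP[y0h y01] d1 d0.
have k0 y : 0 <= 16 * (h * depth x y) `^ half_exp * cmod (B' (cplx x y)) `^ p.
  by rewrite !mulr_ge0 ?powR_ge0.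
have int0 : (0 <= \int[leb]_(y in `[y0, y1])
     (16 * (h * depth x y) `^ half_exp * cmod (B' (cplx x y)) `^ p)%:E)%E.
  by apply: integral_ge0 => y _; rewrite lee_fin.
have b0 := cmod_ge0 (B (cplx x y0)).
have [b1|b1] := eqVneq (B (cplx x y1)) 0.
  by apply: le_trans int0; rewrite lee_fin b1 cmod0; lra.
have [y01'|y01'] := eqVneq y0 y1.
  by apply: le_trans int0; rewrite lee_fin y01' subrr; lra.
have lt01 : y0 < y1 by rewrite lt_neqAle y01'.
have n1 : 0 < cmod (B (cplx x y1)) by rewrite cmod_gt0.
have dpos y : y0 <= y <= y1 -> 0 < depth x y.
  move=> /andP[h1 h2]; apply: lt_le_trans d1 _; apply: depth_le.
  by rewrite h2 andbT; lra.
(* the unimodular c turns B at the upper end point into |B| *)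
pose c := cconj (B (cplx x y1)) / cplx (cmod (B (cplx x y1))) 0.
have c1 : cmod c = 1.
  by rewrite cmodf cmod_conj cmod_real gtr0_norm// divff// gt_eqF.
have cb1 : cre (c * B (cplx x y1)) = cmod (B (cplx x y1)).
  have -> : c * B (cplx x y1) = cplx (cmod (B (cplx x y1))) 0; last by [].
  rewrite /c mulrAC [_ * B _]mulrC mul_cconj.
  have -> : cplx (cmod (B (cplx x y1)) ^+ 2) 0 =
      cplx (cmod (B (cplx x y1))) 0 * cplx (cmod (B (cplx x y1))) 0.
    by rewrite cplxM !mulr0 mul0r subr0 addr0 expr2.
  by rewrite mulfK// cplx_cmod_neq0.
have cle w : cre (c * w) <= cmod w.
  by apply: le_trans (ler_norm _) _; apply: le_trans (cre_le _) _; rewrite cmodM c1 mul1r.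
pose sh := Num.sqrt h; have sh0 : 0 < sh by rewrite sqrtr_gt0.
(* the second summand of F absorbs the threshold *)
pose F y := cre (c * B (cplx x y)) + (8 * sh)^-1 * Num.sqrt (depth x y).
pose f y := cre (c * (cplx 0 1 * B' (cplx x y))) - (8 * sh)^-1 * (y / Num.sqrt (depth x y)).
have sd0 y : y0 <= y <= y1 -> 0 < Num.sqrt (depth x y) by move=> /dpos; rewrite sqrtr_gt0.
have dF y : y0 <= y <= y1 -> is_derive y 1 F (f y).
  move=> yy.
  have H1 : is_derive y 1 (depth x) (- (2 * y)).
    have -> : depth x = cst (1 - x ^+ 2) - (id ^+ 2 : R -> R).
      by apply/funext => t; rewrite /depth /= !fctE.
    by apply: is_derive_eq; rewrite sub0r expr1 /GRing.scale /= mulr1 mulr_natl.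
  have H2 := @is_derive1_comp _ _ _ y _ _ (is_derive1_sqrt (dpos _ yy)) H1.
  have H3 := is_deriveZ (8 * sh)^-1 H2.
  have := is_deriveD (blaschke_line_derive c (dpos _ yy)) H3.
  rewrite /F /f; congr is_derive.
  have := sd0 _ yy; rewrite /GRing.scale /= => h3; field.
  by rewrite !gt_eqF.
have cf y : y0 <= y <= y1 -> {for y, continuous f}.
  move=> yy; have C1 := @blaschke'_line_continuous c _ _ (dpos _ yy).
  have Cd : depth x t @[t --> y] --> depth x y.
    by apply: cvgB; [exact: cvg_cst|exact: exprn_continuous].
  have Cs : Num.sqrt (depth x t) @[t --> y] --> Num.sqrt (depth x y).
    exact: (@continuous_comp _ _ _ (depth x) Num.sqrt y Cd (@sqrt_continuous _ _)).
  have C2 : (8 * sh)^-1 * (t / Num.sqrt (depth x t)) @[t --> y] -->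
      (8 * sh)^-1 * (y / Num.sqrt (depth x y)).
    apply: cvgM; first exact: cvg_cst.
    apply: cvgM; first exact: cvg_id.
    by apply: cvgV Cs; rewrite gt_eqF// sd0.
  exact: (cvgB C1 C2).
have FF : cmod (B (cplx x y1)) - cmod (B (cplx x y0)) - 4^-1 <= F y1 - F y0.
  rewrite /F cb1.
  have h1 : Num.sqrt (depth x y0) <= 2 * sh.
    have -> : 2 * sh = Num.sqrt (4 * h).
      by rewrite sqrtrM// (_ : 4 = 2 ^+ 2) ?sqrtr_sqr ?ger0_norm//; ring.
    exact: ler_wsqrtr.
  have h2 : (8 * sh)^-1 * Num.sqrt (depth x y0) <= 4^-1.
    rewrite mulrC ler_pdivrMr ?mulr_gt0//; lra.
  have h3 : 0 <= (8 * sh)^-1 * Num.sqrt (depth x y1).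
    by rewrite mulr_ge0 ?sqrtr_ge0// invr_ge0 mulr_ge0// ltW.
  have := cle (B (cplx x y0)); lra.
apply: (@le_trans _ _ (F y1 - F y0)%:E); first by rewrite lee_fin.
apply: (FTC_is_derive_le lt01 dF cf) => //.
- apply: measurable_funM; last first.
    apply: (measurableT_comp (measurable_powR p)).
    by apply: measurable_blaschke'_line => //; lra.
  apply: measurable_funM => //; apply: (measurableT_comp (measurable_powR _)).
  by apply: measurable_funM => //; exact: measurable_depth.
- move=> y yy; rewrite /f.
  have sy := sd0 _ yy; have dy := dpos _ yy.
  set g := cmod (B' (cplx x y)).
  have fg : cre (c * (cplx 0 1 * B' (cplx x y))) <= g.
    by apply: le_trans (cle _) _; rewrite cmodM cmod_imag normr1 mul1r.
  pose l := 16 * Num.sqrt (h * depth x y).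
  have lE : l = 16 * sh * Num.sqrt (depth x y) by rewrite /l sqrtrM ?mulrA// ltW.
  have l0 : 0 < l by rewrite lE !mulr_gt0.
  have Y := @young_threshold _ g l p (cmod_ge0 _) l0 p1.
  have lV : l^-1 <= (8 * sh)^-1 * (y / Num.sqrt (depth x y)).
    have -> : (8 * sh)^-1 * (y / Num.sqrt (depth x y)) = (2 * y) * l^-1.
      by rewrite lE; field; rewrite !gt_eqF.
    rewrite ler_peMl ?invr_ge0 ?(ltW l0)//; case/andP: yy; lra.
  have lp : l `^ (p - 1) <= 16 * (h * depth x y) `^ half_exp.
    have hd : 0 <= h * depth x y by rewrite mulr_ge0 ?ltW.
    have -> : l `^ (p - 1) = 16 `^ (p - 1) * (h * depth x y) `^ half_exp.
      by rewrite /half_exp powRrM (powR12_sqrt hd) -powRM// sqrtr_ge0.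
    rewrite ler_wpM2r ?powR_ge0// -[leRHS]powRr1//.
    by apply: ler_powR; [rewrite ler1n|rewrite lerBlDr ltW].
  have gp : 0 <= g `^ p by exact: powR_ge0.
  rewrite lerBlDr; apply: le_trans fg _; apply: le_trans Y _.
  exact: lerD (ler_wpM2r gp lp) lV.
Qed.

End VerticalLine.

(** * Many zeros below one vertical line *)

Lemma powR_le1 (R : realType) (x r : R) : 0 <= r -> 0 <= x <= 1 -> x `^ r <= 1.
Proof.
move=> r0 /andP[x0 x1]; have := ge0_ler_powR r0 x0 ler01 x1.
by rewrite powR1.
Qed.

Section VerticalCluster.
Context {R : realType} (a : nat -> Cplx R).
Hypothesis ha : blaschke_sequence a.
Local Notation mR := (measurableTypeR R).
Local Notation leb := (@lebesgue_measure R).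
Local Notation B := (blaschke a).
Local Notation B' := (derive1 (blaschke a)).
Variable p : R.
Hypothesis hp : 1 < p < 2.
Local Notation tau := (half_exp p).

Lemma half_exp_gt0 : 0 < tau.
Proof. by rewrite mulr_gt0// subr_gt0; case/andP: hp. Qed.

(** The factor h^(1 - p) makes the weight homogeneous of degree 0. *)
Lemma powR_rescale (h d : R) : 0 < h -> 0 <= d ->
  h `^ (1 - p) * (h * d) `^ tau = (d / h) `^ tau.
Proof.
move=> h0 d0; have hge := ltW h0.
rewrite (powRM tau hge d0) (powRM tau d0) ?invr_ge0// mulrA mulrC; congr (_ * _).
rewrite -powR_inv1// -powRrM -powRD ?(gt_eqF h0) ?implybT//.
by congr (_ `^ _); rewrite /half_exp; field.
Qed.

Variables (x y1 q : R) (s : seq nat) (h y : nat -> R).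
Hypotheses (us : uniq s) (d1 : 0 < depth x y1) (q0 : 0 <= q) (q1 : q < 1).
Hypotheses (h0 : forall n, n \in s -> 0 < h n)
  (yb : forall n, n \in s -> 2^-1 <= y n <= y1)
  (dy : forall n, n \in s -> depth x (y n) <= 4 * h n)
  (By : forall n, n \in s -> cmod (B (cplx x (y n))) <= 4^-1)
  (sep : forall i j, i \in s -> j \in s -> i != j ->
    depth x (y i) <= q * depth x (y j) \/ depth x (y j) <= q * depth x (y i)).

Let w n t : R := \1_(`[y n, y1]%classic) t * (depth x t / h n) `^ tau.
Let g t : R := cmod (B' (cplx x t)) `^ p.

Let w0 n t : 0 <= w n t.
Proof. by rewrite mulr_ge0 ?powR_ge0// indicE. Qed.

Let g0 t : 0 <= g t. Proof. exact: powR_ge0. Qed.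

Let dpos t : 0 <= t <= y1 -> 0 < depth x t.
Proof. by move=> tt; apply: lt_le_trans d1 (depth_le _ tt). Qed.

Let mg : measurable_fun (`[2^-1, y1]%classic : set mR) g.
Proof.
apply: (measurableT_comp (measurable_powR p)).
by apply: measurable_blaschke'_line => //; rewrite invr_ge0.
Qed.

Let mw n : measurable_fun (`[2^-1, y1]%classic : set mR) (w n).
Proof.
apply: measurable_funM; first by apply: measurable_indic.
apply: (measurableT_comp (measurable_powR _)).
by apply: measurable_funM => //; exact: measurable_depth.
Qed.

Lemma single_energy n : n \in s ->
  ((h n `^ (1 - p) * (cmod (B (cplx x y1)) - 2^-1))%:E <=
   \int[leb]_(t in `[2^-1%R, y1]) (16 * w n t * g t)%:E)%E.
Proof.
move=> ns; have hn := h0 ns; have /andP[yn1 yn2] := yb ns.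
have H := segment_energy_ge ha hp hn (yb ns) d1 (dy ns).
have m1 : measurable_fun (`[y n, y1]%classic : set mR)
    (fun t => 16 * (h n * depth x t) `^ tau * g t).
  apply: measurable_funM; last first.
    apply: measurable_funS mg => //.
    by apply: subset_itvr; rewrite bnd_simp.
  apply: measurable_funM => //; apply: (measurableT_comp (measurable_powR _)).
  by apply: measurable_funM => //; exact: measurable_depth.
have -> : (\int[leb]_(t in `[2^-1%R, y1]) (16 * w n t * g t)%:E =
   (h n `^ (1 - p))%:E * \int[leb]_(t in `[y n, y1])
     (16 * (h n * depth x t) `^ tau * g t)%:E)%E.
  rewrite -ge0_integralZl_EFin ?powR_ge0//; last 2 first.
  - by move=> t _; rewrite lee_fin !mulr_ge0 ?powR_ge0.
  - exact/measurable_EFinP.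
  rewrite [LHS]integral_mkcond [RHS]integral_mkcond; apply: eq_integral => t _.
  rewrite !patchE /w indicE.
  have [tn|tn] := boolP (t \in `[y n, y1]%classic); last first.
    by rewrite mul0r mulr0 mul0r; case: ifP.
  move: tn; rewrite inE/= in_itv/= => /andP[t1 t2].
  rewrite ifT; last by rewrite inE/= in_itv/= t2 (le_trans yn1).
  rewrite mul1r -EFinM -powR_rescale ?ltW//; last by apply: dpos; rewrite t2; lra.
  by congr EFin; ring.
rewrite EFinM lee_pmul2l ?lte_fin ?powR_gt0//.
apply: le_trans H; rewrite lee_fin; have := By ns; lra.
Qed.

(** At a given height the weight of a point below is comparable with the power tau
of a ratio of depths, at most 1, and two such ratios differ by a factor q^tau. *)
Lemma sum_weights_le t : 2^-1 <= t <= y1 ->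
  \sum_(n <- s) w n t <= 4 `^ tau / (1 - q `^ tau).
Proof.
move=> /andP[t1 t2]; have tau0 := half_exp_gt0.
have dt : 0 < depth x t by apply: dpos; rewrite t2; lra.
have dn n : n \in s -> 0 < depth x (y n).
  by move=> /yb /andP[? ?]; apply: dpos; apply/andP; split=> //; lra.
pose v n := \1_(`[y n, y1]%classic) t * (depth x t / depth x (y n)) `^ tau.
have vE n : n \in s -> w n t <= 4 `^ tau * v n.
  move=> ns; rewrite /w /v mulrCA; apply: ler_wpM2l; first by rewrite indicE.
  have dh : 0 <= depth x t / depth x (y n) by rewrite divr_ge0// ltW// dn.
  rewrite -powRM//; apply: ge0_ler_powR; rewrite ?nnegrE ?(ltW tau0)//.
  - by rewrite divr_ge0// ltW// h0.
  - by rewrite mulr_ge0.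
  rewrite ler_pdivrMr ?h0// -mulrA -ler_pdivrMl// mulrC.
  rewrite [leRHS]mulrAC ler_pdivlMr ?dn//.
  by have := dy ns; nra.
apply: (@le_trans _ _ (4 `^ tau * \sum_(n <- s) v n)).
  by rewrite mulr_sumr big_seq [leRHS]big_seq; apply: ler_sum => n; exact: vE.
rewrite ler_wpM2l ?powR_ge0// -[leRHS]mul1r.
have qt1 : q `^ tau < 1.
  have := @gt0_ltr_powR _ _ tau0 q 1; rewrite powR1 /= !nnegrE; apply => //.
apply: cluster_sum_le; rewrite ?powR_ge0//.
- move=> n ns; rewrite /v mulr_ge0 ?indicE ?powR_ge0//=.
  have [tn|_] := boolP (t \in _); last by rewrite mul0r.
  move: tn; rewrite inE/= in_itv/= => /andP[t3 _]; rewrite mul1r.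
  apply: powR_le1 (ltW tau0) _; rewrite (divr_ge0 (ltW dt) (ltW (dn _ ns)))/=.
  rewrite ler_pdivrMr ?dn// mul1r; apply: depth_le; rewrite t3 andbT.
  by have /andP[? _] := yb ns; lra.
have half i j : i \in s -> j \in s -> depth x (y i) <= q * depth x (y j) ->
    v j <= q `^ tau * v i \/ v i <= q `^ tau * v j.
  move=> si sj dij; rewrite /v [X in X * _ <= _ \/ _]indicE.
  have [ti|ti] := boolP (t \in `[y i, y1]%classic); last first.
    by right; rewrite indicE (negbTE ti) mul0r mulr_ge0 ?powR_ge0// mulr_ge0 ?powR_ge0// indicE.
  left; rewrite indicE ti mul1r -powRM//; last by rewrite divr_ge0// ltW// dn.
  apply: (@le_trans _ _ ((depth x t / depth x (y j)) `^ tau)).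
    by rewrite ler_piMl ?powR_ge0//; case: (t \in _).
  apply: ge0_ler_powR; rewrite ?nnegrE ?(ltW tau0)//.
  - by rewrite divr_ge0// ltW// dn.
  - by rewrite mulr_ge0// divr_ge0// ltW// dn.
  rewrite mulrCA ler_pM2l// ler_pdivlMr ?dn// mulrC ler_pdivrMr ?dn//.
move=> i j si sj ij; have [d|d] := sep si sj ij; last exact: half.
by have [?|?] := half _ _ si sj d; [right|left].
Qed.

Lemma vertical_cluster :
  (\sum_(n <- s) (h n `^ (1 - p) * (cmod (B (cplx x y1)) - 2^-1))%:E <=
   (16 * (4 `^ tau / (1 - q `^ tau)))%:E *
   \int[leb]_(t in `[2^-1%R, y1]) (cmod (B' (cplx x t)) `^ p)%:E)%E.
Proof.
have C0 : 0 <= 4 `^ tau / (1 - q `^ tau).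
  rewrite divr_ge0 ?powR_ge0// subr_ge0.
  by apply: powR_le1 (ltW half_exp_gt0) _; rewrite q0 ltW.
apply: (@le_trans _ _ (\sum_(n <- s) \int[leb]_(t in `[2^-1%R, y1]) (16 * w n t * g t)%:E)%E).
  by rewrite big_seq [leRHS]big_seq; apply: lee_sum => n; exact: single_energy.
have m1 n : measurable_fun (`[2^-1, y1]%classic : set mR) (fun t => (16 * w n t * g t)%:E).
  by apply/measurable_EFinP; apply: measurable_funM => //; apply: measurable_funM.
have k0 n t : (0 <= (16 * w n t * g t)%:E)%E.
  by rewrite lee_fin; apply: mulr_ge0 => //; exact: mulr_ge0.
rewrite -ge0_integral_sum//.
have C16 : 0 <= 16 * (4 `^ tau / (1 - q `^ tau)) by rewrite mulr_ge0.
have gE0 t : (`[2^-1, y1]%classic : set mR) t -> (0 <= (cmod (B' (cplx x t)) `^ p)%:E)%E.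
  by move=> _; rewrite lee_fin powR_ge0.
have mgE : measurable_fun (`[2^-1, y1]%classic : set mR)
    (fun t => (cmod (B' (cplx x t)) `^ p)%:E) by exact/measurable_EFinP.
rewrite -ge0_integralZl_EFin//.
apply: ge0_le_integral => //.
- by move=> t _; apply: sume_ge0.
- exact: emeasurable_sum.
- by apply/measurable_EFinP; apply: measurable_funM.
- move=> t /=; rewrite in_itv/= => tt; rewrite sumEFin -EFinM lee_fin -mulr_suml.
  by rewrite ler_wpM2r// -mulr_sumr ler_wpM2l// sum_weights_le.
Qed.

End VerticalCluster.

(** * Separation of the zeros seen from a vertical line *)

Section ZerosNearLine.
Context {R : realType} (a : nat -> Cplx R) (delta eps : R).
Hypotheses (ha : blaschke_sequence a) (delta1 : delta <= 1)
  (hsep : forall m n : nat, m != n -> delta <= pseudohyperbolic (a m) (a n))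
  (eps0 : 0 < eps) (eps4 : eps <= 4^-1) (eps_delta : 4 * eps <= delta).
Local Notation B := (blaschke a).
Local Notation h := (gap a).

(** Every zero with gap at most 1/4 satisfies this after a rotation by a multiple
of a right angle, because (3/4)^2 exceeds 1/2. *)
Definition upper_zero n := (2^-1 <= cim (a n)) && (gap a n <= 4^-1).

Definition near_zero x n := `|x - cre (a n)| <= eps * gap a n.

Lemma cmod_zero n : cmod (a n) = 1 - h n.
Proof. by rewrite /gap subKr. Qed.

Lemma zero_reim n : cre (a n) ^+ 2 + cim (a n) ^+ 2 = (1 - h n) ^+ 2.
Proof. by rewrite -cmod_zero sqr_cmod. Qed.

Lemma near_zero_depth n x : upper_zero n -> near_zero x n ->
  h n <= depth x (cim (a n)) <= 4 * h n.
Proof.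
move=> /andP[b2 h4]; rewrite /near_zero ler_norml => /andP[x1 x2].
have h0 := gap_gt0 ha n; have E := zero_reim n.
have c1 : `|cre (a n)| <= 1 by rewrite (le_trans (cre_le _))// cmod_zero; lra.
move: c1; rewrite ler_norml => /andP[c1 c2].
have eh : eps * h n <= 4^-1 * h n by rewrite ler_wpM2r// ltW.
set u := x - cre (a n) in x1 x2.
have xE : x = cre (a n) + u by rewrite /u addrC subrK.
rewrite /depth xE; move: x1 x2; rewrite -/u; clearbody u; clear xE.
move: (cre (a n)) (cim (a n)) (h n) E b2 h4 h0 c1 c2 eh.
move=> c b k E b2 k4 k0 c1 c2 eh x1 x2.
have u1 : - (4^-1 * k) <= u by lra.
have u2 : u <= 4^-1 * k by lra.
have -> : 1 - (c + u) ^+ 2 - b ^+ 2 = 1 - (1 - k) ^+ 2 - 2 * c * u - u ^+ 2.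
  by rewrite -E; ring.
have cu : - (4^-1 * k) <= c * u <= 4^-1 * k by apply/andP; split; nra.
move/andP: cu => [cu1 cu2].
have uu : 0 <= u ^+ 2 <= 16^-1 * k by rewrite sqr_ge0 /=; nra.
by move/andP: uu => [uu1 uu2]; apply/andP; split; nra.
Qed.

(** At the height of the zero the point of the line is within pseudohyperbolic
distance eps of it. *)
Lemma near_zero_small n x : upper_zero n -> near_zero x n ->
  cmod (B (cplx x (cim (a n)))) <= 4^-1.
Proof.
move=> un xn; have /andP[dl _] := near_zero_depth un xn.
have h0 := gap_gt0 ha n.
have z1 : cmod (cplx x (cim (a n))) < 1 by rewrite -depth_gt0 (lt_le_trans h0).
have [_ a1] : 0 < cmod (a n) /\ cmod (a n) < 1 by case: ha => /(_ n) /andP.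
apply: le_trans (cmod_blaschke_le_factor ha n z1) _.
rewrite cmod_factor; last by case: ha => /(_ n) /andP[].
have -> : a n - cplx x (cim (a n)) = cplx (cre (a n) - x) 0.
  by rewrite [in LHS](cplx_eta (a n)) cplxN cplxD subrr.
rewrite cmod_real distrC.
have dd := cmod_den_ge_l a1 (ltW z1).
rewrite ler_pdivrMr; last exact: lt_le_trans dd.
apply: le_trans xn _; apply: ler_pM => //; exact: ltW.
Qed.

(** Two zeros whose real parts lie close to that of the same vertical line can
only be separated hyperbolically through their imaginary parts, so their depths
differ by a fixed factor. *)
Lemma near_zero_sep i j x : i != j ->
  upper_zero i -> upper_zero j -> near_zero x i -> near_zero x j ->
  depth x (cim (a i)) <= (1 - delta / 16) * depth x (cim (a j)) \/
  depth x (cim (a j)) <= (1 - delta / 16) * depth x (cim (a i)).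
Proof.
move=> ij ui uj xi xj.
wlog bij : i j ij ui uj xi xj / cim (a i) <= cim (a j).
  move=> H; have [le|/ltW le] := leP (cim (a i)) (cim (a j)); first exact: H.
  by rewrite eq_sym in ij; have [?|?] := H j i ij uj ui xj xi le; [right|left].
right.
have /andP[di1 di2] := near_zero_depth ui xi.
have hi := gap_gt0 ha i; have hj := gap_gt0 ha j.
have ai1 : cmod (a i) < 1 by case: ha => /(_ i) /andP[].
have aj1 : cmod (a j) < 1 by case: ha => /(_ j) /andP[].
have denl : h j <= cmod (blaschke_den (a j) (a i)) := cmod_den_ge_l aj1 (ltW ai1).
have denr : h i <= cmod (blaschke_den (a j) (a i)) := cmod_den_ge_r (a i) aj1.
have D : delta * cmod (blaschke_den (a j) (a i)) <= cmod (a i - a j).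
  have := hsep ij; rewrite /pseudohyperbolic cmodf -/(blaschke_den _ _).
  by rewrite ler_pdivlMr// (lt_le_trans hj).
have T : cmod (a i - a j) <= `|cre (a i) - cre (a j)| + (cim (a j) - cim (a i)).
  apply: le_trans (cmod_le_reim _) _; rewrite creD creN cimD cimN.
  by rewrite [X in _ + X]distrC (ger0_norm (_ : 0 <= cim (a j) - _)) ?subr_ge0.
have U : `|cre (a i) - cre (a j)| <= eps * h i + eps * h j.
  have -> : cre (a i) - cre (a j) = (x - cre (a j)) - (x - cre (a i)) by ring.
  by apply: le_trans (ler_normB _ _) _; rewrite addrC; apply: lerD.
have /andP[bi _] := ui; have /andP[bj _] := uj.
have d0 : 0 < delta by apply: lt_le_trans eps_delta; rewrite mulr_gt0.
set L := cmod (blaschke_den (a j) (a i)) in denl denr D.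
have q1 : delta * h i <= delta * L by rewrite ler_wpM2l// ltW.
have q2 : delta * h j <= delta * L by rewrite ler_wpM2l// ltW.
have e1 : 4 * (eps * h i) <= delta * h i by rewrite mulrA ler_wpM2r// ltW.
have e2 : 4 * (eps * h j) <= delta * h j by rewrite mulrA ler_wpM2r// ltW.
(* the real parts account for at most half of delta times the denominator *)
have gapb : delta * h i / 4 <= cim (a j) - cim (a i) by lra.
have -> : depth x (cim (a j)) = depth x (cim (a i)) -
    (cim (a j) - cim (a i)) * (cim (a j) + cim (a i)) by rewrite /depth; ring.
have : delta * depth x (cim (a i)) <= delta * (4 * h i) by rewrite ler_wpM2l// ltW.
have := ler_wpM2l (_ : 0 <= cim (a j) - cim (a i)) (_ : 1 <= cim (a j) + cim (a i)).
rewrite subr_ge0 => /(_ bij) => H1 H2.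
have {}H1 : cim (a j) - cim (a i) <= (cim (a j) - cim (a i)) * (cim (a j) + cim (a i)).
  by rewrite -[leLHS]mulr1 H1//; lra.
move: H1 H2 gapb; move: (_ * (cim (a j) + _)) => P H1 H2 gapb; lra.
Qed.

End ZerosNearLine.

(** * Means of 1 - |B| near the unit circle *)

Section BoundaryValues.
Context {R : realType} (a : nat -> Cplx R).
Hypothesis ha : blaschke_sequence a.
Local Notation mR := (measurableTypeR R).
Local Notation leb := (@lebesgue_measure R).
Local Notation B := (blaschke a).
Local Notation h := (gap a).

(** In 1 - |b|^2 = (1 - |a|^2) (1 - |z|^2) / |1 - conj a z|^2 the denominator is
bounded below by the square of each of h, s and |x - Re a|. *)
Lemma defect_bounds (n : nat) (x y s : R) : 0 < s < 1 -> cmod (cplx x y) = 1 - s ->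
  1 - cmod (blaschke_factor (a n) (cplx x y)) ^+ 2 <= 4 * s / h n /\
  1 - cmod (blaschke_factor (a n) (cplx x y)) ^+ 2 <=
    8 * h n * (s / (s ^+ 2 + (x - cre (a n)) ^+ 2)).
Proof.
move=> /andP[s0 s1] zs; have a01 : 0 < cmod (a n) < 1 by case: ha.
have h0 := gap_gt0 ha n; have h1 := gap_lt1 ha n.
have z1 : cmod (cplx x y) < 1 by rewrite zs; lra.
have /andP[_ a1] := a01.
rewrite one_sub_sqr_factor// zs cmod_zero.
have dl : h n <= cmod (blaschke_den (a n) (cplx x y)) := cmod_den_ge_l a1 (ltW z1).
have dr : s <= cmod (blaschke_den (a n) (cplx x y)).
  by have := cmod_den_ge_r (cplx x y) a1; rewrite zs subKr.
have dx : `|x - cre (a n)| <= cmod (blaschke_den (a n) (cplx x y)).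
  apply: le_trans (cmod_sub_le_den a01 z1); rewrite cmodBC.
  by apply: le_trans (cre_le _); rewrite creD creN.
set L := cmod (blaschke_den (a n) (cplx x y)) in dl dr dx *.
have L0 : 0 < L by apply: lt_le_trans dr.
have E1 : (1 - (1 - h n) ^+ 2) * (1 - (1 - s) ^+ 2) <= 4 * s * h n.
  have -> : 4 * s * h n = (2 * h n) * (2 * s) by ring.
  by apply: ler_pM; nra.
have dx2 : (x - cre (a n)) ^+ 2 <= L ^+ 2.
  by rewrite -(real_normK (num_real (x - _))) ler_pXn2r ?nnegrE ?normr_ge0 ?(ltW L0).
have ds2 : s ^+ 2 <= L ^+ 2 by rewrite ler_pXn2r ?nnegrE ?(ltW L0) ?(ltW s0).
have dh2 : h n ^+ 2 <= L ^+ 2 by rewrite ler_pXn2r ?nnegrE ?(ltW L0) ?(ltW h0).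
have L2 : 0 < L ^+ 2 by rewrite exprn_gt0.
have P0 : 0 < s ^+ 2 + (x - cre (a n)) ^+ 2 by rewrite ltr_pwDl ?sqr_ge0 ?exprn_gt0.
split.
- rewrite ler_pdivrMr// mulrAC ler_pdivlMr//.
  apply: (@le_trans _ _ (4 * s * h n * h n)); first by rewrite ler_wpM2r// ltW.
  by rewrite -mulrA -expr2 ler_wpM2l// mulr_ge0// ltW.
- rewrite ler_pdivrMr//.
  have -> : 8 * h n * (s / (s ^+ 2 + (x - cre (a n)) ^+ 2)) * L ^+ 2 =
    8 * h n * s * L ^+ 2 / (s ^+ 2 + (x - cre (a n)) ^+ 2) by ring.
  rewrite ler_pdivlMr//.
  apply: (@le_trans _ _ (4 * s * h n * (s ^+ 2 + (x - cre (a n)) ^+ 2))).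
    by rewrite ler_wpM2r// ltW.
  have -> : 8 * h n * s * L ^+ 2 = 4 * s * h n * (L ^+ 2 + L ^+ 2) by ring.
  by rewrite ler_wpM2l ?lerD// !mulr_ge0// ltW.
Qed.

(** Up to a constant, the half-plane Poisson kernel at height s centred at Re a,
with mass proportional to the gap of a. *)
Definition poisson_term (s x : R) (n : nat) : R :=
  8 * h n * (s / (s ^+ 2 + (x - cre (a n)) ^+ 2)).

(** It bounds 1 - |B| on the circle of radius 1 - s: the first M zeros are treated
as far away, the others through the Poisson kernel. *)
Definition boundary_majorant (M : nat) (s x : R) : \bar R :=
  ((\sum_(0 <= n < M) 4 * s / h n)%R%:E +
   \sum_(n <oo) (poisson_term s x (n + M))%:E)%E.

Lemma poisson_term_ge0 (n : nat) (s x : R) : 0 < s ->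
  0 <= poisson_term s x n.
Proof.
move=> s0; rewrite /poisson_term mulr_ge0//; first by rewrite mulr_ge0// ltW// gap_gt0.
by rewrite divr_ge0 ?addr_ge0 ?sqr_ge0// ltW.
Qed.

Lemma one_sub_blaschke_le (M : nat) (x y s : R) : 0 < s < 1 ->
  cmod (cplx x y) = 1 - s ->
  ((1 - cmod (B (cplx x y)))%:E <= boundary_majorant M s x)%E.
Proof.
move=> s01 zs; have /andP[s0 s1] := s01.
have z1 : cmod (cplx x y) < 1 by rewrite zs; lra.
have H K : (M <= K)%N ->
    ((1 - cmod (partial_blaschke a K (cplx x y)))%:E <= boundary_majorant M s x)%E.
  move=> MK; apply: (@le_trans _ _
    (\sum_(0 <= n < M) 4 * s / h n +
     \sum_(M <= n < K) poisson_term s x n)%:E).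
    rewrite lee_fin; apply: le_trans (one_sub_partial_le ha K z1) _.
    rewrite (big_cat_nat (leq0n M) MK)/=; apply: lerD; apply: ler_sum => n _.
      by case: (defect_bounds n s01 zs).
    by case: (defect_bounds n s01 zs).
  rewrite EFinD; apply: leeD => //; rewrite -sumEFin -{1}(add0n M) big_addn.
  by apply: nneseries_lim_ge => n _ _; rewrite lee_fin poisson_term_ge0.
have m0 : (-oo < boundary_majorant M s x)%E by apply: lt_le_trans (H M (leqnn M)); exact: ltNyr.
move E : (boundary_majorant M s x) m0 H => [r| |] // _ H; last exact: leey.
rewrite lee_fin.
have cv : (fun K => 1 - cmod (partial_blaschke a K (cplx x y))) @ \oo -->
    1 - cmod (B (cplx x y)).
  by apply: cvgB; [exact: cvg_cst|exact: cvg_cmod (cvg_blaschke ha z1)].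
rewrite -(cvg_lim _ cv)//; apply: limr_le; first by apply/cvg_ex; eexists; exact: cv.
by near=> K; rewrite -lee_fin; apply: H; near: K; exact: nbhs_infty_ge.
Unshelve. all: by end_near. Qed.

Lemma measurable_poisson_kernel (s t : R) (D : set mR) : 0 < s ->
  measurable_fun D (fun x => (s / (s ^+ 2 + (x - t) ^+ 2))%:E).
Proof.
move=> s0; apply: measurable_funS (@measurableT _ mR) (@subsetT _ _) _.
apply/measurable_EFinP; apply: continuous_measurable_fun => x.
apply: cvgM; first exact: cvg_cst.
apply: cvgV; first by rewrite gt_eqF// ltr_pwDl ?sqr_ge0 ?exprn_gt0.
apply: cvgD; first exact: cvg_cst.
apply: (@cvg_comp _ _ _ (fun x => x - t) (fun x => x ^+ 2)); last exact: exprn_continuous.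
by apply: cvgB; [exact: cvg_id|exact: cvg_cst].
Qed.

Lemma measurable_poisson_term (n : nat) (s : R) (D : set mR) : 0 < s ->
  measurable_fun D (fun x => (poisson_term s x n)%:E).
Proof.
move=> s0; rewrite /poisson_term; apply/measurable_EFinP; apply: measurable_funM => //.
by have /measurable_EFinP := @measurable_poisson_kernel s (cre (a n)) D s0.
Qed.

Lemma measurable_poisson_series (M : nat) (s : R) (D : set mR) : 0 < s ->
  measurable_fun D (fun x => (\sum_(n <oo) (poisson_term s x (n + M))%:E)%E).
Proof.
move=> s0; apply: (@ge0_emeasurable_sum _ _ _ D
  (fun n x => (poisson_term s x (n + M))%:E) xpredT) => [n x _ _|n _].
  by rewrite lee_fin poisson_term_ge0.
exact: measurable_poisson_term.
Qed.

Lemma measurable_boundary_majorant (M : nat) (s : R) (D : set mR) : 0 < s ->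
  measurable_fun D (boundary_majorant M s).
Proof. by move=> s0; apply: emeasurable_funD => //; exact: measurable_poisson_series. Qed.

Lemma boundary_majorant_ge0 (M : nat) (s x : R) : 0 < s ->
  (0 <= boundary_majorant M s x)%E.
Proof.
move=> s0; apply: adde_ge0.
  rewrite lee_fin; apply: sumr_ge0 => n _.
  by rewrite mulr_ge0 ?invr_ge0 ?mulr_ge0// ltW// gap_gt0.
by apply: nneseries_ge0 => n _ _; rewrite lee_fin poisson_term_ge0.
Qed.

Lemma integral_boundary_majorant_le (M : nat) (s : R) : 0 < s ->
  (\int[leb]_(x in `[(-1)%R, 1%R]) boundary_majorant M s x <=
   (2 * \sum_(0 <= n < M) 4 * s / h n)%R%:E + \sum_(n <oo) (8 * pi * h (n + M))%R%:E)%E.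
Proof.
move=> s0; rewrite ge0_integralD//; last 3 first.
- move=> x _; rewrite lee_fin; apply: sumr_ge0 => n _.
  by rewrite mulr_ge0 ?invr_ge0 ?mulr_ge0// ltW// gap_gt0.
- by move=> x _; apply: nneseries_ge0 => n _ _; rewrite lee_fin poisson_term_ge0.
- exact: measurable_poisson_series.
apply: leeD.
  rewrite integral_cst//= lebesgue_measure_itv/= lte_fin ifT; last by lra.
  by rewrite -EFinB -EFinM lee_fin opprK mulrC.
rewrite integral_nneseries//; last 2 first.
- by move=> n; exact: measurable_poisson_term.
- by move=> n x _; rewrite lee_fin poisson_term_ge0.
apply: lee_nneseries => [n *|n *].
  by apply: integral_ge0 => x _; rewrite lee_fin poisson_term_ge0.
have h0 := ltW (gap_gt0 ha (n + M)).
have mk := @measurable_poisson_kernel s (cre (a (n + M))) `[(-1)%R, 1%R]%classic s0.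
under eq_integral do rewrite /poisson_term EFinM.
rewrite ge0_integralZl_EFin ?mulr_ge0//; last first.
  by move=> x _; rewrite lee_fin divr_ge0 ?addr_ge0 ?sqr_ge0// ltW.
have -> : (8 * pi * h (n + M))%:E = ((8 * h (n + M))%:E * pi%:E)%E.
  by rewrite -EFinM; congr EFin; ring.
by rewrite lee_wpmul2l ?lee_fin ?mulr_ge0// integral_poisson_le.
Qed.

(** The means of 1 - |B| over circles tend to zero: all but finitely many zeros
contribute little because the Poisson kernel has bounded mass, and the remaining
ones contribute O(s). *)
Lemma boundary_majorant_small (eta : R) : 0 < eta -> exists M : nat, exists2 s1 : R, 0 < s1 &
  forall s : R, 0 < s <= s1 ->
    (\int[leb]_(x in `[(-1)%R, 1%R]) boundary_majorant M s x <= eta%:E)%E.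
Proof.
move=> eta0.
have p8 : 0 < 8 * pi :> R by rewrite mulr_gt0// pi_gt0.
pose e := eta / 2 / (8 * pi).
have e0 : 0 < e by rewrite !divr_gt0.
have [M HM] : exists M, limn (series h) - series h M <= e.
  have /cvgrPdist_le /(_ _ e0) [M _ HM] : series h @ \oo --> limn (series h) := cvg_gap ha.
  by exists M; have := HM M (leqnn M); apply: le_trans; exact: ler_norm.
pose T := \sum_(0 <= n < M) 8 / h n.
have T0 : 0 <= T by apply: sumr_ge0 => n _; rewrite divr_ge0// ltW// gap_gt0.
exists M, (eta / 2 / (T + 1)); first by rewrite !divr_gt0// ltr_wpDl.
move=> s /andP[s0 ss1]; apply: le_trans (integral_boundary_majorant_le M s0) _.
rewrite (splitr eta) EFinD; apply: leeD.
  rewrite lee_fin.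
  have -> : 2 * \sum_(0 <= n < M) 4 * s / h n = s * T.
    by rewrite /T !mulr_sumr; apply: eq_bigr => n _; ring.
  rewrite ler_pdivlMr in ss1; last by rewrite ltr_wpDl.
  by apply: le_trans ss1; rewrite ler_wpM2l ?lerDl// ltW.
apply: lime_le.
  by apply: is_cvg_nneseries => n _ _; rewrite lee_fin !mulr_ge0 ?pi_ge0// ltW// gap_gt0.
apply: nearW => K; rewrite sumEFin lee_fin.
rewrite -mulr_sumr mulrC -ler_pdivlMr//; apply: le_trans HM.
rewrite lerBrDl; apply: le_trans (series_gap_le ha (K + M)).
rewrite /series /= (big_cat_nat (leq0n M) (leq_addl K M))/=.
by rewrite lerD2l -{2}(add0n M) big_addn addnK.
Qed.

End BoundaryValues.

(** * Zeros of imaginary part at least 1/2 *)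

Section Energy.
Context {R : realType} (a : nat -> Cplx R) (p : R).
Hypothesis ha : blaschke_sequence a.
Local Notation mR := (measurableTypeR R).
Local Notation B' := (derive1 (blaschke a)).

Definition disc : set (mR * mR) := [set w | unit_disc (cplx w.1 w.2)].

Definition energy : mR * mR -> \bar R :=
  (fun w => (cmod (B' (cplx w.1 w.2)) `^ p)%:E) \_ disc.

Lemma cplx_box_lt (x y x' y' e : R) : `|x' - x| < e -> `|y' - y| < e ->
  cmod (cplx x' y' - cplx x y) < e + e.
Proof.
move=> hx hy; apply: le_lt_trans (cmod_le_reim _) _.
by rewrite /cre /cim /=; exact: ltrD.
Qed.

Lemma cmod_cplx_box_lt (x y x' y' e : R) : `|x' - x| < e -> `|y' - y| < e ->
  cmod (cplx x' y') < cmod (cplx x y) + (e + e).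
Proof.
move=> hx hy; rewrite -ltrBlDl.
by apply: le_lt_trans (cmod_subl _ _) _; exact: cplx_box_lt.
Qed.

Lemma box_open_disc : box_open disc.
Proof.
move=> x y; rewrite /disc /unit_disc /= => z1.
exists ((1 - cmod (cplx x y)) / 2); first by rewrite divr_gt0 ?subr_gt0.
move=> x' y' hx hy; have := cmod_cplx_box_lt hx hy.
by rewrite -splitr addrC subrK.
Qed.

Lemma measurable_energy : measurable_fun setT energy.
Proof.
have mD : measurable disc := box_open_measurable box_open_disc.
apply/(measurable_restrictT _ mD)/measurable_EFinP.
apply: (measurableT_comp (measurable_powR p)).
apply: box_continuous_measurable box_open_disc _ => x y z1' e e0.
have z1 : cmod (cplx x y) < 1 := z1'; set m := cmod (cplx x y) in z1.
have r1 : (m + 1) / 2 < 1 by lra.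
have [C HC] := blaschke'_lipschitz ha r1.
have C0 : 0 < `|C| + 1 by rewrite ltr_wpDl.
exists (Num.min ((1 - m) / 4) (e / (`|C| + 1) / 2)).
  by rewrite lt_min !divr_gt0// subr_gt0.
move=> x' y' _; rewrite !lt_min => /andP[hx1 hx2] /andP[hy1 hy2] /=.
have w1 := cmod_cplx_box_lt hx1 hy1; have w2 := cplx_box_lt hx2 hy2.
rewrite -splitr ltr_pdivlMr// in w2.
have H : cmod (B' (cplx x' y') - B' (cplx x y)) < e.
  apply: le_lt_trans (HC _ _ _ _) _; rewrite -/m; [lra|rewrite -/m in w1; lra|].
  apply: le_lt_trans w2; rewrite mulrC ler_wpM2l ?cmod_ge0//.
  by apply: le_trans (ler_norm C) _; rewrite lerDl.
exact: le_lt_trans (cmod_dist _ _) H.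
Qed.

Lemma energy_ge0 w : (0 <= energy w)%E.
Proof. by rewrite /energy patchE; case: ifP => // _; rewrite lee_fin powR_ge0. Qed.

Lemma energyE (x y : R) : 0 < depth x y ->
  energy (x, y) = (cmod (B' (cplx x y)) `^ p)%:E.
Proof. by rewrite depth_gt0 => d; rewrite /energy patchE ifT// inE. Qed.

Lemma energy_out (x y : R) : ~~ (0 < depth x y) -> energy (x, y) = 0%E.
Proof.
by rewrite depth_gt0 => /negP d; rewrite /energy patchE memNset.
Qed.

End Energy.

Section OneDirection.
Context {R : realType} (a : nat -> Cplx R) (p delta eps : R).
Hypotheses (hp : 1 < p < 2) (ha : blaschke_sequence a) (delta1 : delta <= 1)
  (hsep : forall m n : nat, m != n -> delta <= pseudohyperbolic (a m) (a n))
  (eps0 : 0 < eps) (eps4 : eps <= 4^-1) (eps_delta : 4 * eps <= delta).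
Local Notation mR := (measurableTypeR R).
Local Notation leb := (@lebesgue_measure R).
Local Notation B := (blaschke a).
Local Notation h := (gap a).
Local Notation tau := (half_exp p).

Let delta0 : 0 < delta.
Proof. by apply: lt_le_trans eps_delta; rewrite mulr_gt0. Qed.

Let q := 1 - delta / 16.
Let q0 : 0 <= q. Proof. by rewrite /q; move: delta1; lra. Qed.
Let q1 : q < 1. Proof. by rewrite /q; move: delta0; lra. Qed.

Let C := 16 * (4 `^ tau / (1 - q `^ tau)).

Definition shadow n : set mR :=
  `[cre (a n) - eps * h n, cre (a n) + eps * h n]%classic.

Lemma shadowP n x : shadow n x <-> near_zero a eps x n.
Proof.
rewrite /shadow /near_zero /= in_itv/= ler_distl.
by split.
Qed.

Lemma line_constant_ge0 : 0 <= C.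
Proof.
have tau0 := half_exp_gt0 hp.
rewrite /C mulr_ge0// divr_ge0 ?powR_ge0// subr_ge0.
by apply: powR_le1 (ltW tau0) _; rewrite q0 ltW.
Qed.

(** Integrating |B'| upwards from the zeros to the circle of radius 1 - s: what
the increments of |B| miss is controlled by 1 - |B| on that circle. *)
Lemma line_inequality (M : nat) (s x : R) (S : seq nat) : uniq S -> 0 < s < 1 ->
  (forall n, n \in S -> upper_zero a n) ->
  (forall n, n \in S -> 2 * s <= h n) ->
  (\sum_(n <- S) (\1_(shadow n) x * (h n `^ (1 - p) / 2))%:E <=
   (\sum_(n <- S) h n `^ (1 - p))%R%:E * boundary_majorant a M s x +
   C%:E * \int[leb]_y energy a p (x, y))%E.
Proof.
move=> uS /andP[s0 s1] uz hs.
have m0 := boundary_majorant_ge0 ha M x s0.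
have K0 : 0 <= \sum_(n <- S) h n `^ (1 - p).
  by apply: sumr_ge0 => n _; exact: powR_ge0.
have E0 : (0 <= \int[leb]_y energy a p (x, y))%E.
  by apply: integral_ge0 => y _; exact: energy_ge0.
pose Sx := [seq n <- S | x \in shadow n].
have -> : (\sum_(n <- S) (\1_(shadow n) x * (h n `^ (1 - p) / 2))%:E =
    (\sum_(n <- Sx) h n `^ (1 - p) / 2)%:E)%E.
  rewrite sumEFin big_filter [in RHS]big_mkcond; congr EFin; apply: eq_bigr => n _.
  by rewrite indicE; case: (x \in _); rewrite ?mul1r ?mul0r.
have SxP n : n \in Sx -> n \in S /\ near_zero a eps x n.
  by rewrite mem_filter => /andP[/set_mem/shadowP].
have [Sx0|[n0 n0x]] : Sx = [::] \/ exists n, n \in Sx.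
- by case: (Sx) => [|n r]; [left|right; exists n; rewrite mem_head].
- rewrite Sx0 big_nil; apply: adde_ge0; apply: mule_ge0 => //; rewrite lee_fin//.
  exact: line_constant_ge0.
have dS n : n \in Sx -> h n <= depth x (cim (a n)) <= 4 * h n.
  by move=> /SxP[nS nx]; apply: (near_zero_depth (eps := eps)) => //; exact: uz.
(* the line meets the circle of radius 1 - s at height y1, above the zeros *)
pose y1 := Num.sqrt ((1 - s) ^+ 2 - x ^+ 2).
have yle n : n \in Sx -> cim (a n) ^+ 2 <= (1 - s) ^+ 2 - x ^+ 2.
  move=> nx; have /andP[dn _] := dS _ nx; have [nS _] := SxP _ nx.
  by have := hs _ nS; rewrite /depth in dn; nra.
have yS n : n \in Sx -> 2^-1 <= cim (a n) <= y1.
  move=> nx; have [nS _] := SxP _ nx; have /andP[b2 _] := uz _ nS; rewrite b2 /=.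
  rewrite /y1 -[leLHS]ger0_norm; last by lra.
  by rewrite -sqrtr_sqr ler_wsqrtr// yle.
have y1sq : y1 ^+ 2 = (1 - s) ^+ 2 - x ^+ 2.
  by rewrite sqr_sqrtr// (le_trans (sqr_ge0 _) (yle _ n0x)).
have zs : cmod (cplx x y1) = 1 - s.
  by rewrite cmod_cplx y1sq addrC subrK sqrtr_sqr ger0_norm// subr_ge0 ltW.
have d1 : 0 < depth x y1 by rewrite depth_gt0 zs; lra.
have V := @vertical_cluster _ a ha p hp x y1 q Sx h (fun n => cim (a n))
  (filter_uniq _ uS) d1 q0 q1.
have {}V : (\sum_(n <- Sx) (h n `^ (1 - p) * (cmod (B (cplx x y1)) - 2^-1))%:E <=
   C%:E * \int[leb]_(t in `[2^-1%R, y1]) (cmod (derive1 B (cplx x t)) `^ p)%:E)%E.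
  apply: V => //.
  - by move=> n _; exact: gap_gt0.
  - by move=> n nx; have /andP[] := dS _ nx.
  - move=> n nx; have [nS nz] := SxP _ nx.
    by apply: (near_zero_small (eps := eps)) => //; exact: uz.
  - move=> i j /SxP[iS iz] /SxP[jS jz] ij.
    by apply: (near_zero_sep (eps := eps)) => //; exact: uz.
have IE : (\int[leb]_(t in `[2^-1%R, y1]) (cmod (derive1 B (cplx x t)) `^ p)%:E <=
    \int[leb]_y energy a p (x, y))%E.
  have -> : (\int[leb]_(t in `[2^-1%R, y1]) (cmod (derive1 B (cplx x t)) `^ p)%:E =
     \int[leb]_(t in `[2^-1%R, y1]) energy a p (x, t))%E.
    apply: eq_integral => t; rewrite inE/= in_itv/= => /andP[t1 t2].
    rewrite energyE//; apply: lt_le_trans d1 _; apply: depth_le.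
    by rewrite t2 andbT; lra.
  apply: ge0_subset_integral => //.
  - by apply: measurableT_comp (measurable_energy p ha) (measurable_pair1 x).
  - by move=> y _; exact: energy_ge0.
have bd := one_sub_blaschke_le ha M (_ : 0 < s < 1) zs.
rewrite s0 s1 in bd; have {}bd := bd isT.
(* 1/2 = (1 - |B|) + (|B| - 1/2) at the upper end point *)
apply: (@le_trans _ _ ((\sum_(n <- Sx) h n `^ (1 - p))%:E * (1 - cmod (B (cplx x y1)))%:E +
   \sum_(n <- Sx) (h n `^ (1 - p) * (cmod (B (cplx x y1)) - 2^-1))%:E)%E).
  rewrite sumEFin -EFinM -EFinD lee_fin mulr_suml -big_split/=.
  by apply: ler_sum => n _; rewrite le_eqVlt; apply/orP; left; apply/eqP; field.
apply: leeD.
  apply: (@le_trans _ _ ((\sum_(n <- Sx) h n `^ (1 - p))%:E * boundary_majorant a M s x)%E).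
    by apply: lee_wpmul2l => //; rewrite lee_fin; apply: sumr_ge0 => n _; exact: powR_ge0.
  apply: lee_wpmul2r => //; rewrite lee_fin big_filter [leLHS]big_mkcond/=.
  by apply: ler_sum => n _; case: ifP => // _; exact: powR_ge0.
apply: le_trans V _; apply: lee_wpmul2l => //; rewrite lee_fin; exact: line_constant_ge0.
Qed.

Hypothesis J_lty : (\int[leb]_x \int[leb]_y energy a p (x, y) < +oo)%E.

Lemma shadow_sub n : upper_zero a n -> shadow n `<=` `[(-1)%R, 1%R]%classic.
Proof.
move=> /andP[b2 h4] x /shadowP; rewrite /near_zero ler_norml /= in_itv/= => /andP[x1 x2].
have h0 := gap_gt0 ha n; have E := zero_reim a n.
have eh : eps * h n <= 4^-1 * h n by rewrite ler_wpM2r// ltW.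
have c1 : `|cre (a n)| <= 1 - h n by rewrite (le_trans (cre_le _))// cmod_zero.
move: c1; rewrite ler_norml => /andP[c1 c2]; apply/andP; split; lra.
Qed.

Lemma measure_shadow n : upper_zero a n ->
  leb (shadow n `&` `[(-1)%R, 1%R]%classic) = (2 * (eps * h n))%:E.
Proof.
move=> un; rewrite setIidl; last exact: shadow_sub.
have eh : 0 < eps * h n by rewrite mulr_gt0// gap_gt0.
rewrite /shadow lebesgue_measure_itv/= lte_fin ifT; last by lra.
by rewrite -EFinB; congr EFin; ring.
Qed.

(** Integrate the inequality on vertical lines over the abscissa: each zero
contributes its weight times the width of its shadow, that is a multiple of
h^(2 - p), and the boundary term is made small by letting s tend to 0. *)
Lemma upper_zeros_bounded : exists K : R, forall N : nat,
  \sum_(0 <= n < N | upper_zero a n) h n `^ (2 - p) <= K.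
Proof.
pose J := (\int[leb]_x \int[leb]_y energy a p (x, y))%E.
have J0 : (0 <= J)%E.
  by apply: integral_ge0 => x _; apply: integral_ge0 => y _; exact: energy_ge0.
have Jfin : J \is a fin_num by rewrite ge0_fin_numE.
exists ((1 + C * fine J) / eps) => N.
pose S := [seq n <- index_iota 0 N | upper_zero a n].
have uS : uniq S by rewrite filter_uniq// iota_uniq.
have uz n : n \in S -> upper_zero a n by rewrite mem_filter => /andP[].
pose W := \sum_(n <- S) h n `^ (1 - p).
have W0 : 0 <= W by apply: sumr_ge0 => n _; exact: powR_ge0.
have W1 : 0 < W + 1 by rewrite ltr_wpDl.
have [M [s1 s10 Hs]] := boundary_majorant_small ha (divr_gt0 ltr01 W1).
(* 2 s below all the gaps keeps the finitely many zeros inside the circle of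
   radius 1 - s *)
have [s [s0 ss1 ss2 sS]] : exists s : R, [/\ 0 < s, s <= s1, s < 1 &
    forall n, n \in S -> 2 * s <= h n].
  have [t t0 tS] : exists2 t : R, 0 < t & forall n, n \in S -> 2 * t <= h n.
    elim: (S) => [|m r [t t0 tr]]; first by exists 1.
    exists (Num.min t (h m / 2)); first by rewrite lt_min t0 divr_gt0// gap_gt0.
    move=> n; rewrite inE => /predU1P[->|nr].
      by rewrite mulrC -ler_pdivlMr// ge_min lexx orbT.
    by apply: le_trans (tr _ nr); rewrite ler_pM2l// ge_min lexx.
  exists (Num.min (Num.min t s1) 2^-1); split.
  - by rewrite !lt_min t0 s10 invr_gt0 ltr0n.
  - by rewrite !ge_min lexx orbT.
  - by rewrite gt_min invf_lt1// ltr1n orbT.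
  - by move=> n /tS; apply: le_trans; rewrite ler_pM2l// !ge_min lexx.
have s01 : 0 < s < 1 by rewrite s0.
have key x := @line_inequality M s x S uS s01 uz sS.
have mI n : measurable (shadow n) by exact: measurable_itv.
have mterm n (D : set mR) : measurable_fun D
    (fun x => (\1_(shadow n) x * (h n `^ (1 - p) / 2))%:E).
  by apply/measurable_EFinP; apply: measurable_funM => //; exact: measurable_indic.
have term0 n (x : mR) : (0 <= (\1_(shadow n) x * (h n `^ (1 - p) / 2))%:E)%E.
  by rewrite lee_fin mulr_ge0 ?indicE// divr_ge0 ?powR_ge0.
have mE : measurable_fun setT (fun x => \int[leb]_y energy a p (x, y))%E.
  apply: (measurable_fun_fubini_tonelli_F (m2 := leb) (energy a p)).
    exact: measurable_energy.
  exact: energy_ge0.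
have E0 x : (0 <= \int[leb]_y energy a p (x, y))%E.
  by apply: integral_ge0 => y _; exact: energy_ge0.
have I1 : (\int[leb]_(x in `[(-1)%R, 1%R])
     \sum_(n <- S) (\1_(shadow n) x * (h n `^ (1 - p) / 2))%:E =
   (\sum_(n <- S) eps * h n `^ (2 - p))%:E)%E.
  rewrite ge0_integral_sum// -sumEFin big_seq [RHS]big_seq; apply: eq_bigr => n nS.
  under eq_integral do rewrite mulrC EFinM.
  rewrite ge0_integralZl_EFin ?divr_ge0 ?powR_ge0//; last first.
    by apply/measurable_EFinP; exact: measurable_indic.
  rewrite integral_indic//= measure_shadow ?uz// -EFinM; congr EFin.
  have -> : h n `^ (2 - p) = h n `^ (1 - p) * h n.
    rewrite -[X in _ * X]powRr1 ?ltW ?gap_gt0// -powRD; first by congr (_ `^ _); ring.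
    by rewrite (gt_eqF (gap_gt0 ha n)) implybT.
  by field.
have I2 : (\int[leb]_(x in `[(-1)%R, 1%R]) (W%:E * boundary_majorant a M s x +
    C%:E * \int[leb]_y energy a p (x, y)) <= (1 + C * fine J)%:E)%E.
  rewrite ge0_integralD//; last 4 first.
  - by move=> x _; apply: mule_ge0; rewrite ?lee_fin// boundary_majorant_ge0.
  - by apply: measurable_funeM; exact: measurable_boundary_majorant.
  - by move=> x _; apply: mule_ge0; rewrite ?lee_fin ?line_constant_ge0.
  - by apply: measurable_funeM; exact: measurable_funS mE.
  rewrite ge0_integralZl_EFin//; last 2 first.
  - by move=> x _; exact: boundary_majorant_ge0.
  - exact: measurable_boundary_majorant.
  rewrite ge0_integralZl_EFin ?line_constant_ge0//; last exact: measurable_funS mE.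
  rewrite EFinD; apply: leeD.
    apply: (@le_trans _ _ (W%:E * (1 / (W + 1))%:E)%E).
      by apply: lee_wpmul2l; rewrite ?lee_fin// Hs// s0.
    by rewrite -EFinM lee_fin mulrA mulr1 ler_pdivrMr// mul1r lerDl.
  rewrite (EFinM C (fine J)) fineK//; apply: lee_wpmul2l.
    by rewrite lee_fin line_constant_ge0.
  by apply: ge0_subset_integral.
have L : (\int[leb]_(x in `[(-1)%R, 1%R])
     \sum_(n <- S) (\1_(shadow n) x * (h n `^ (1 - p) / 2))%:E <=
   \int[leb]_(x in `[(-1)%R, 1%R]) (W%:E * boundary_majorant a M s x +
    C%:E * \int[leb]_y energy a p (x, y)))%E.
  apply: ge0_le_integral => //.
  - by move=> x _; apply: sume_ge0.
  - exact: emeasurable_sum.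
  - apply: emeasurable_funD; first by apply: measurable_funeM; exact: measurable_boundary_majorant.
    by apply: measurable_funeM; exact: measurable_funS mE.
have {L I2} := le_trans L I2; rewrite I1 lee_fin.
by rewrite -mulr_sumr big_filter mulrC ler_pdivlMr.
Qed.

End OneDirection.

(** * Rotations and conclusion *)

Section Rotation.
Context {R : realType} (a : nat -> Cplx R) (p : R) (v : Cplx R).
Hypotheses (ha : blaschke_sequence a) (v1 : cmod v = 1).
Local Notation mR := (measurableTypeR R).
Local Notation leb := (@lebesgue_measure R).

(** The product with these zeros is z |-> B (v z). *)
Definition rotate n : Cplx R := cconj v * a n.

Let vK : v * cconj v = 1.
Proof. by rewrite mul_cconj v1 expr1n. Qed.

Lemma cmod_rotate n : cmod (rotate n) = cmod (a n).
Proof. by rewrite cmodM cmod_conj v1 mul1r. Qed.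

Lemma gap_rotate : gap rotate = gap a.
Proof. by apply/funext => n; rewrite /gap cmod_rotate. Qed.

Lemma rotate_blaschke_sequence : blaschke_sequence rotate.
Proof.
case: ha => a01 cv; split => [n|]; first by rewrite cmod_rotate.
by under eq_fun do rewrite cmod_rotate.
Qed.

Lemma rotate_den n z : blaschke_den (rotate n) z = blaschke_den (a n) (v * z).
Proof. by rewrite /blaschke_den /rotate cconjM cconjK; congr (1 - _); ring. Qed.

Lemma rotate_pseudohyperbolic m n :
  pseudohyperbolic (rotate m) (rotate n) = pseudohyperbolic (a m) (a n).
Proof.
rewrite /pseudohyperbolic !cmodf -!/(blaschke_den _ _) rotate_den /rotate mulrA vK mul1r.
by rewrite -mulrBr cmodM cmod_conj v1 mul1r.
Qed.

Lemma rotate_factor n z : blaschke_factor (rotate n) z = blaschke_factor (a n) (v * z).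
Proof.
rewrite !factorE rotate_den /blaschke_phase cmod_rotate.
have -> : a n - v * z = v * (rotate n - z) by rewrite mulrBr /rotate mulrA vK mul1r.
by rewrite /rotate cconjM cconjK; ring.
Qed.

Lemma rotate_blaschke z : blaschke rotate z = blaschke a (v * z).
Proof.
have H : (fun N => \prod_(0 <= n < N) blaschke_factor (rotate n) z) =
    (fun N => \prod_(0 <= n < N) blaschke_factor (a n) (v * z)).
  by apply/funext => N; apply: eq_bigr => n _; exact: rotate_factor.
by rewrite /blaschke H.
Qed.

Lemma rotate_blaschke' z : cmod z < 1 ->
  derive1 (blaschke rotate) z = v * derive1 (blaschke a) (v * z).
Proof.
move=> z1; have [r /andP[zr r1]] : exists r, cmod z < r < 1.
  by exists ((cmod z + 1) / 2); rewrite midf_lt//=; rewrite midf_lt.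
have [C HC] := blaschke_remainder ha r1.
have e0 : 0 < r - cmod z by rewrite subr_gt0.
apply: (proj2 (@quad_remainder_derive _ _ _ _ _ C e0 _)) => w wz.
have wr : cmod w <= r.
  rewrite -(subrK z w); apply: le_trans (cmodD _ _) _.
  by rewrite addrC -lerBrDl; exact: ltW.
have vM u : cmod (v * u) = cmod u by rewrite cmodM v1 mul1r.
have := HC (v * z) (v * w); rewrite -mulrBr !vM !rotate_blaschke => /(_ (ltW zr) wr).
by rewrite mulrA [(w - z) * v]mulrC.
Qed.

Lemma energy_rotate (x y : R) : energy rotate p (x, y) =
  energy a p (cre (v * cplx x y), cim (v * cplx x y)).
Proof.
have E : cmod (v * cplx x y) = cmod (cplx x y) by rewrite cmodM v1 mul1r.
have [d|d] := boolP (0 < depth x y).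
  have d' : 0 < depth (cre (v * cplx x y)) (cim (v * cplx x y)).
    by rewrite depth_gt0 -cplx_eta E -depth_gt0.
  rewrite (energyE _ _ d) (energyE _ _ d') -cplx_eta rotate_blaschke' -?depth_gt0//.
  by rewrite cmodM v1 mul1r.
have d' : ~~ (0 < depth (cre (v * cplx x y)) (cim (v * cplx x y))).
  by rewrite depth_gt0 -cplx_eta E -depth_gt0.
by rewrite (energy_out _ _ d) (energy_out _ _ d').
Qed.

Hypotheses (hp : 1 < p < 2) (hsep : uniformly_discrete a).

Lemma rotated_zeros_bounded :
  (\int[leb]_x \int[leb]_y
     energy a p (cre (v * cplx x y), cim (v * cplx x y)) < +oo)%E ->
  exists K : R, forall N : nat,
    \sum_(0 <= n < N | upper_zero rotate n) gap a n `^ (2 - p) <= K.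
Proof.
move=> J; case: hsep => d0 d00 hd0.
pose delta := Num.min d0 1; have delta0 : 0 < delta by rewrite lt_min d00 ltr01.
have delta1 : delta <= 1 by rewrite ge_min lexx orbT.
rewrite -gap_rotate.
have hs m n : m != n -> delta <= pseudohyperbolic (rotate m) (rotate n).
  move=> mn; rewrite rotate_pseudohyperbolic; apply: le_trans (hd0 _ _ mn).
  by rewrite ge_min lexx.
have e0 : 0 < delta / 4 by rewrite divr_gt0.
have e4 : delta / 4 <= 4^-1 by rewrite ler_pdivrMr// mulVf.
have ed : 4 * (delta / 4) <= delta by rewrite mulrC divfK.
have J' : (\int[leb]_x \int[leb]_y energy rotate p (x, y) < +oo)%E.
  by under eq_integral => x _ do under eq_integral => y _ do rewrite energy_rotate.
exact: (@upper_zeros_bounded R rotate p delta (delta / 4) hp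
  rotate_blaschke_sequence delta1 hs e0 e4 ed J').
Qed.

End Rotation.

Section FourDirections.
Context {R : realType} (a : nat -> Cplx R) (p : R).
Hypotheses (ha : blaschke_sequence a) (hp : 1 < p < 2) (hsep : uniformly_discrete a).
Local Notation mR := (measurableTypeR R).
Local Notation leb := (@lebesgue_measure R).
Hypothesis hJ : (\int[@product_measure1 _ _ _ _ _ leb leb]_w energy a p w < +oo)%E.

Let mE := measurable_energy p ha.
Let E0 := @energy_ge0 R a p.

Lemma cmod_i : cmod (cplx 0 1 : Cplx R) = 1.
Proof. by rewrite cmod_imag normr1. Qed.

Lemma cmod_Ni : cmod (cplx 0 (-1) : Cplx R) = 1.
Proof. by rewrite cmod_imag normrN1. Qed.

Lemma directions_bounded v : v \in [:: 1; -1; cplx 0 1; cplx 0 (-1)] ->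
  exists K : R, forall N : nat,
    \sum_(0 <= n < N | upper_zero (rotate a v) n) gap a n `^ (2 - p) <= K.
Proof.
rewrite !inE => /or4P[] /eqP ->; apply: rotated_zeros_bounded => //.
- exact: cmod1.
- under eq_integral => x _ do under eq_integral => y _ do rewrite mul1r.
  by rewrite (tonelli_xy mE E0).
- by rewrite cmodN cmod1.
- under eq_integral => x _ do under eq_integral => y _ do rewrite mulN1r creN cimN.
  by rewrite (tonelli_NxNy mE E0).
- exact: cmod_i.
- under eq_integral => x _ do under eq_integral => y _ do
    rewrite cplxM !mul0r !mul1r sub0r add0r.
  by rewrite (tonelli_Nyx mE E0).
- exact: cmod_Ni.
- under eq_integral => x _ do under eq_integral => y _ do
    rewrite cplxM !mul0r !mulN1r sub0r add0r opprK.
  by rewrite (tonelli_yNx mE E0).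
Qed.

Lemma cim_rotate v n : cim (rotate a v n) = cre v * cim (a n) - cim v * cre (a n).
Proof. by rewrite /rotate; case: v => u w; case: (a n) => x y /=; ring. Qed.

Lemma near_zero_direction n : gap a n <= 4^-1 ->
  [|| upper_zero (rotate a 1) n, upper_zero (rotate a (-1)) n,
      upper_zero (rotate a (cplx 0 1)) n | upper_zero (rotate a (cplx 0 (-1))) n].
Proof.
move=> h4; have E := zero_reim a n; have h0 := gap_gt0 ha n.
rewrite /upper_zero !gap_rotate ?cmodN ?cmod1 ?cmod_i ?cmod_Ni// h4 !andbT !cim_rotate.
have -> : cre (1 : Cplx R) = 1 by [].
have -> : cim (1 : Cplx R) = 0 by [].
have -> : cre (- 1 : Cplx R) = - 1 by [].
have -> : cim (- 1 : Cplx R) = 0 by exact: oppr0.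
rewrite /= !mul0r !mul1r !mulN1r !subr0 !sub0r opprK.
apply/negPn; rewrite !negb_or -!ltNge; apply/negP => /and4P[h1 h2 h3 h5].
have : (1 - gap a n) ^+ 2 < 2^-1 by rewrite -E; nra.
nra.
Qed.

(** Each term is at most the sum of its occurrences in the four directions and of
4 h, the latter covering the gaps larger than 1/4. *)
Lemma zeros_bounded : exists K : R, forall N : nat,
  \sum_(0 <= n < N) gap a n `^ (2 - p) <= K.
Proof.
have [K1 H1] := @directions_bounded 1 (mem_head _ _).
have [K2 H2] := @directions_bounded (-1) ltac:(by rewrite !inE eqxx ?orbT).
have [K3 H3] := @directions_bounded (cplx 0 1) ltac:(by rewrite !inE eqxx ?orbT).
have [K4 H4] := @directions_bounded (cplx 0 (-1)) ltac:(by rewrite !inE eqxx ?orbT).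
exists (K1 + (K2 + (K3 + (K4 + 4 * limn (series (gap a)))))) => N.
apply: le_trans (lerD (H1 N) (lerD (H2 N) (lerD (H3 N) (lerD (H4 N)
  (ler_wpM2l (ler0n _ 4) (series_gap_le ha N)))))).
pose t v n := if upper_zero (rotate a v) n then gap a n `^ (2 - p) else 0.
rewrite /series /= mulr_sumr.
apply: (@le_trans _ _ (\sum_(0 <= n < N) (t 1 n + (t (-1) n +
  (t (cplx 0 1) n + (t (cplx 0 (-1)) n + 4 * gap a n)))))); last first.
  by rewrite !big_split/= -!big_mkcond.
apply: ler_sum => n _; rewrite /t.
have h0 := gap_gt0 ha n; have h1 := gap_lt1 ha n.
have P0 : 0 <= gap a n `^ (2 - p) by exact: powR_ge0.
have ge0 (b : bool) : 0 <= (if b then gap a n `^ (2 - p) else 0) by case: b.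
have [h4|h4] := leP (gap a n) 4^-1.
  have h40 : 0 <= 4 * gap a n by rewrite mulr_ge0// ltW.
  have := near_zero_direction h4; case/or4P => ->;
  have := ge0 (upper_zero (rotate a 1) n); have := ge0 (upper_zero (rotate a (-1)) n);
  have := ge0 (upper_zero (rotate a (cplx 0 1)) n);
  have := ge0 (upper_zero (rotate a (cplx 0 (-1))) n); lra.
have P1 : gap a n `^ (2 - p) <= 1.
  apply: powR_le1; first by case/andP: hp => _ ?; rewrite subr_ge0 ltW.
  by rewrite !ltW.
have := ge0 (upper_zero (rotate a 1) n); have := ge0 (upper_zero (rotate a (-1)) n);
have := ge0 (upper_zero (rotate a (cplx 0 1)) n);
have := ge0 (upper_zero (rotate a (cplx 0 (-1))) n); lra.
Qed.

End FourDirections.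
Theorem theorem2 (R : realType) (p : R) (a : nat -> Cplx R)
    (hp : 1 < p < 2)
    (ha : blaschke_sequence a)
    (hsep : uniformly_discrete a)
    (hB : bergman p (derive1 (blaschke a))) :
  cvgn (series (fun n => (1 - cmod (a n)) `^ (2 - p) : R)).
Proof.
case: hB => _ hI.
have hJ : (\int[@product_measure1 _ _ _ _ _ (@lebesgue_measure R) (@lebesgue_measure R)]_w
    energy a p w < +oo)%E.
  move: hI; rewrite integral_mkcond -/(energy a p); move: (integral _ _ _) => I.
  case: I => [r _| |//]; first exact: ltry.
  by rewrite mulry gtr0_sg ?invr_gt0 ?pi_gt0// mul1e.
have [K HK] := zeros_bounded ha hp hsep hJ.
apply: nondecreasing_is_cvgn.
  by apply/nondecreasing_seqP => n; rewrite seriesS lerDr powR_ge0.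
exists K => _ [N _ <-]; exact: HK.
Qed.
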